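(* (i) For all $n\ge1$, $A_{1,3}(n)=\dfrac{2}{4^n}\zeta(4n+1)$. (ii) For all $n\ge0$, $B_{1,3}(n)=\dfrac{1}{4^n}\zeta(4n+3)$.
   Context: Skew diagrams: for partitions $\lambda=(\lambda_1,\dots,\lambda_h)$, $\mu=(\mu_1,\dots,\mu_r)$ with $\mu_j<\lambda_j$ ($\mu_j=0$ for $j>r$), $D(\lambda/\mu)=\{(i,j):1\le i\le h,\mu_i<j\le\lambda_i\}$; corners are cells $(i,j)$ with $(i,j+1),(i+1,j)\notin D$. For a filling $\mathbf k=(k_{i,j})$ by positive integers with entries $\ge2$ at corners, $\zeta(\mathbf k)=\sum\prod m_{i,j}^{-k_{i,j}}$ over fillings $(m_{i,j})$ by positive integers, strictly increasing down columns ($m_{i,j}<m_{i+1,j}$) and weakly increasing along rows ($m_{i,j}\le m_{i,j+1}$). For positive integers $a$, $b\ge2$, the diagram is checkerboardable if there is a (unique) filling $\mathbf k_{a,b}$ with $k_{i,j}$ depending only on the parity of $i-j$, equal to $a$ on one parity class and $b$ on the other, and equal to $b$ at all corners; $\zeta(a,b;\lambda/\mu):=\zeta(\mathbf k_{a,b})$. Notation: $\delta_n=(n,\dots,1)$, $\delta_0=\delta_{-1}=\emptyset$. $A_{1,3}(n)=\zeta(1,3;(n+1,n+1,n,n-1,\dots,3,2)/\delta_n)$ (outer partition with $n+1$ parts) and $B_{1,3}(n)=\zeta(1,3;\delta_{n+1}/\delta_{n-1})$. $\zeta(s)$ is the Riemann zeta function. *)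

(* Defs.v *)
From HB Require Import structures.
From mathcomp Require Import all_boot all_order all_algebra.
From mathcomp Require Import all_classical all_reals all_analysis.
From mathcomp Require Import zify.

Set Implicit Arguments.
Unset Strict Implicit.
Unset Printing Implicit Defensive.

Import Order.TTheory GRing.Theory Num.Theory.
Import numFieldNormedType.Exports.

Local Open Scope classical_set_scope.
Local Open Scope ring_scope.

Definition is_partition (lam : seq nat) : Prop :=
  sorted geq lam /\ all (leq 1) lam.

(* Rows and columns are numbered from 1; mu is padded with zeros. *)
Definition part (lam : seq nat) (i : nat) : nat := nth 0%N lam i.-1.

Definition skew_shape (lam mu : seq nat) : Prop :=
  [/\ is_partition lam, is_partition mu, (size mu <= size lam)%N &
      forall j, (1 <= j <= size lam)%N -> (part mu j < part lam j)%N].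

Definition in_diagram (lam mu : seq nat) (i j : nat) : bool :=
  (1 <= i <= size lam)%N && (part mu i < j <= part lam i)%N.

Definition is_corner (lam mu : seq nat) (i j : nat) : bool :=
  [&& in_diagram lam mu i j, ~~ in_diagram lam mu i j.+1
    & ~~ in_diagram lam mu i.+1 j].

(* The finite type of cells of the diagram: lam being nonincreasing, the
   column index is at most its first part. *)
Definition cell (lam mu : seq nat) : finType :=
  {c : 'I_(size lam).+1 * 'I_(head 0%N lam).+1 | in_diagram lam mu c.1 c.2}.

Definition cell_row lam mu (c : cell lam mu) : nat := (val c).1.
Definition cell_col lam mu (c : cell lam mu) : nat := (val c).2.

Definition filling (lam mu : seq nat) := {ffun cell lam mu -> nat}.

Definition semistandard lam mu : set (filling lam mu) :=
  [set m | [/\ forall c, (0 < m c)%N,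
               forall c d, cell_row d = (cell_row c).+1 -> cell_col d = cell_col c ->
                 (m c < m d)%N
             & forall c d, cell_row d = cell_row c -> cell_col d = (cell_col c).+1 ->
                 (m c <= m d)%N]].

(* A sum of nonnegative terms, taken in the extended reals: it is finite
   exactly when the series converges. *)
Definition schur_zeta (R : realType) lam mu (k : filling lam mu) : \bar R :=
  \esum_(m in @semistandard lam mu)
     (\prod_(c : cell lam mu) ((m c)%:R ^+ k c)^-1)%:E.

(* The parity of i - j is that of i + j. *)
Definition is_checkerboard (a b : nat) lam mu (k : filling lam mu) : Prop :=
  (exists e : bool, forall c,
     k c = if odd (cell_row c + cell_col c) == e then b else a) /\
  (forall c, is_corner lam mu (cell_row c) (cell_col c) -> k c = b).

Definition checkerboardable (a b : nat) (lam mu : seq nat) : Prop :=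
  exists k : filling lam mu, is_checkerboard a b k.

(* The default [ffun=> b] is only used for diagrams that are not
   checkerboardable. *)
Definition checkerboard_filling (a b : nat) lam mu : filling lam mu :=
  xget [ffun=> b] [set k | is_checkerboard a b k].

Definition checkerboard_zeta (R : realType) (a b : nat) (lam mu : seq nat) :
  \bar R := schur_zeta R (checkerboard_filling a b lam mu).

(* staircase 0 = [::], and n.-1 = 0 for n = 0, which accounts for
   delta_(-1) = delta_0. *)
Definition staircase (n : nat) : seq nat := rev (iota 1 n).

Definition A_outer (n : nat) : seq nat := n.+1 :: rev (iota 2 n).

Definition A13 (R : realType) (n : nat) : \bar R :=
  checkerboard_zeta R 1 3 (A_outer n) (staircase n).

Definition B13 (R : realType) (n : nat) : \bar R :=
  checkerboard_zeta R 1 3 (staircase n.+1) (staircase n.-1).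

(* Only meaningful for s >= 2, where the series converges. *)
Definition riemann_zeta (R : realType) (s : nat) : R :=
  limn (series (fun m : nat => ((m.+1)%:R ^+ s)^-1 : R)).

(* Sanity facts: the diagrams of A13 and B13 are skew shapes, they are
   checkerboardable, and a checkerboard filling is unique as soon as the
   diagram has a corner. *)

Lemma part_staircase n i : (1 <= i)%N -> part (staircase n) i = (n.+1 - i)%N.
Proof.
move=> i1; rewrite /part /staircase.
have [h|h] := ltnP i.-1 n; last by rewrite nth_default ?size_rev ?size_iota //; lia.
rewrite nth_rev ?size_iota // nth_iota; lia.
Qed.

Lemma part_A_outer n i : (2 <= i <= n.+1)%N -> part (A_outer n) i = (n.+3 - i)%N.
Proof.
case: i => [|[|i]]; try lia; rewrite /part /= => h.
rewrite nth_rev ?size_iota //; try lia; rewrite nth_iota; lia.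
Qed.

Lemma staircase_partition n : is_partition (staircase n).
Proof.
split; last by rewrite /staircase all_rev; apply/allP => x; rewrite mem_iota; lia.
rewrite /staircase rev_sorted.
exact: iota_sorted.
Qed.

Lemma A_skew_shape n : skew_shape (A_outer n) (staircase n).
Proof.
split; last 1 first.
- move=> j; rewrite /= size_rev size_iota => h; rewrite part_staircase; last lia.
  have [->|j1] := eqVneq j 1%N; first by rewrite /part /=; lia.
  by rewrite part_A_outer; lia.
- split=> /=; last by rewrite all_rev; apply/allP => x; rewrite mem_iota; lia.
  have /= := rev_sorted geq (rcons (iota 2 n) n.+1).
  rewrite rev_rcons /= => ->.
  have -> : (fun x y : nat => geq y x) = leq by [].
  have := iota_sorted 2 n; case: n => [//|n] /=.
  rewrite rcons_path => -> /=.
  have -> m : last m (iota m.+1 n) = (m + n)%N.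
    by elim: n m => [|n IH] m /=; rewrite ?addn0 // IH addSnnS.
  by [].
- exact: staircase_partition.
- by rewrite /= !size_rev !size_iota; lia.
Qed.

Lemma B_skew_shape n : skew_shape (staircase n.+1) (staircase n.-1).
Proof.
split; try exact: staircase_partition.
- by rewrite !size_rev !size_iota; lia.
- by move=> j; rewrite size_rev size_iota => h; rewrite !part_staircase; lia.
Qed.

Lemma corner_sum_checkerboardable (a b s : nat) lam mu :
  (forall i j, is_corner lam mu i j -> (i + j)%N = s) ->
  checkerboardable a b lam mu.
Proof.
move=> H; exists [ffun c => if odd (cell_row c + cell_col c) == odd s then b else a].
by split=> [|c /H <-]; [exists (odd s) => c|]; rewrite ffunE ?eqxx.
Qed.

Lemma A_checkerboardable a b n : (1 <= n)%N ->
  checkerboardable a b (A_outer n) (staircase n).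
Proof.
move=> n1; apply: (@corner_sum_checkerboardable a b n.+3) => i j.
rewrite /is_corner /in_diagram /= size_rev size_iota.
have p1 : part (A_outer n) 1 = n.+1 by [].
case: i => [|[|i]]; first by [].
  by rewrite p1 part_A_outer ?part_staircase //; lia.
move=> h; have hi : (i.+2 <= n.+1)%N by lia.
move: h; rewrite part_A_outer ?part_staircase //; lia.
Qed.

Lemma B_checkerboardable a b n :
  checkerboardable a b (staircase n.+1) (staircase n.-1).
Proof.
apply: (@corner_sum_checkerboardable a b n.+2) => i j.
rewrite /is_corner /in_diagram size_rev size_iota.
by case: i => [//|i]; rewrite !part_staircase //; lia.
Qed.

Lemma checkerboard_fillingP a b lam mu : checkerboardable a b lam mu ->
  is_checkerboard a b (checkerboard_filling a b lam mu).
Proof. by move=> [k hk]; apply: (xgetPex _ (ex_intro _ k hk)). Qed.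

Lemma checkerboard_corner_uniq a b lam mu (k l : filling lam mu) :
  (exists c : cell lam mu, is_corner lam mu (cell_row c) (cell_col c)) ->
  is_checkerboard a b k -> is_checkerboard a b l -> k = l.
Proof.
move=> [c0 hc] [[e hk] kb] [[f hl] lb]; apply/ffunP => c.
have := kb _ hc; have := lb _ hc; rewrite !hk !hl.
by case: e {hk} (odd (cell_row c0 + cell_col c0)) (odd (cell_row c + cell_col c)) => [] [] [];
   case: f {hl} => //=.
Qed.

(* Main.v *)
Require Import Defs.
From mathcomp Require Import all_boot all_order all_algebra.
From mathcomp Require Import all_classical all_reals all_analysis.
From mathcomp Require Import ring lra zify.
Import Order.TTheory GRing.Theory Num.Theory.
Import numFieldNormedType.Exports.
Local Open Scope classical_set_scope.
Local Open Scope ring_scope.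

(** The cells of both diagrams form a zigzag [.. b >= a < b >= a < ..], each [a]
    carrying the exponent 1 and each [b] the exponent 3.  Cut off at [N], the
    generating function in [x] of these sums is expressed by two solutions
    [(p, q)] of the recurrence
      [p_(n+1) = p_n - x q_n / (n+1)^3],  [q_(n+1) = q_n + p_n / (n+1)]
    ([transfer] below): up to [O(x^(n+1))] it is [q/p] for the first family and
    [- p'/p] for the second.  For [x = 4 a^2] the recurrence is the one of the
    coefficients of products [C_a C_(-a)], where [C_a = 2F1(sqrt a, - sqrt a; 1; t)]
    satisfies [(t d/dt)^2 C = - a t/(1-t) C]; the second solution involves the
    logarithmic companion of [C_a].  Since the partial sums of the coefficients of
    [C_a] are [prod_(k <= n) (1 - a / k^2)], the limits of the quotients are
    explicit partial fractions in [a], whose expansions in [x] give the zeta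
    values.  Coefficients are compared by letting [N] tend to infinity and then
    [x] to 0. *)

(** * Partial sums, products and the Euler operator on coefficient sequences *)

(** On power series this is multiplication by [t/(1-t)], the factor in the differential equation;
    hence the sum stops before [n]. *)
Definition usum {R : realType} (f : nat -> R) n := \sum_(i < n) f i.

Definition conv {R : realType} (f g : nat -> R) n :=
  \sum_(i < n.+1) f i * g (n - i)%N.

(** The operator [t d/dt]; [theta_conv] is its Leibniz rule. *)
Definition theta {R : realType} (f : nat -> R) n := n%:R * f n.

Lemma usumS {R : realType} (f : nat -> R) n : usum f n.+1 = usum f n + f n.
Proof. by rewrite /usum big_ord_recr. Qed.

Lemma usum0 {R : realType} (f : nat -> R) : usum f 0%N = 0.
Proof. by rewrite /usum big_ord0. Qed.

Lemma usumD {R : realType} (f g : nat -> R) n :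
  usum (fun i => f i + g i) n = usum f n + usum g n.
Proof. by rewrite /usum big_split. Qed.

Lemma usumZ {R : realType} (k : R) (f : nat -> R) n :
  usum (fun i => k * f i) n = k * usum f n.
Proof. by rewrite /usum mulr_sumr. Qed.

Lemma eq_usum {R : realType} (f g : nat -> R) n :
  (forall i, (i < n)%N -> f i = g i) -> usum f n = usum g n.
Proof. by move=> fg; apply: eq_bigr => i _; apply: fg. Qed.

Lemma usumN {R : realType} (f : nat -> R) n :
  usum (fun i => - f i) n = - usum f n.
Proof. by rewrite /usum sumrN. Qed.

Lemma le_usum {R : realType} (f g : nat -> R) n :
  (forall i, (i < n)%N -> f i <= g i) -> usum f n <= usum g n.
Proof. by move=> fg; apply: ler_sum => i _; apply: fg. Qed.

Lemma usum_ge0 {R : realType} (f : nat -> R) n :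
  (forall i, (i < n)%N -> 0 <= f i) -> 0 <= usum f n.
Proof. by move=> f0; apply: sumr_ge0 => i _; apply: f0. Qed.

Lemma ler_norm_usum {R : realType} (f : nat -> R) n :
  `|usum f n| <= usum (fun i => `|f i|) n.
Proof. exact: ler_norm_sum. Qed.

Lemma convC {R : realType} (f g : nat -> R) n : conv f g n = conv g f n.
Proof.
rewrite /conv (reindex_inj rev_ord_inj) /=; apply: eq_bigr => i _.
by rewrite subSS mulrC; congr (g _ * _); have := ltn_ord i; lia.
Qed.

Lemma theta_conv {R : realType} (f g : nat -> R) n :
  n%:R * conv f g n = conv (theta f) g n + conv f (theta g) n.
Proof.
rewrite /conv mulr_sumr -big_split; apply: eq_bigr => i _ /=.
have -> : n%:R = i%:R + (n - i)%:R :> R.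
  by rewrite -natrD subnKC // -ltnS ltn_ord.
by rewrite /theta; ring.
Qed.

Lemma usum_conv {R : realType} (f g : nat -> R) n :
  usum (conv f g) n = conv (usum f) g n.
Proof.
elim: n => [|n IH]; first by rewrite usum0 /conv big_ord1 usum0 mul0r.
rewrite usumS IH [RHS]/conv big_ord_recl usum0 mul0r add0r.
rewrite /conv -big_split; apply: eq_bigr => i _ /=.
by rewrite /bump /= add1n usumS subSS mulrDl.
Qed.

Lemma eq_conv {R : realType} (f f' g g' : nat -> R) n :
  f =1 f' -> g =1 g' -> conv f g n = conv f' g' n.
Proof. by move=> ff gg; apply: eq_bigr => i _; rewrite ff gg. Qed.

Lemma convDl {R : realType} (f f' g : nat -> R) n :
  conv (fun i => f i + f' i) g n = conv f g n + conv f' g n.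
Proof. by rewrite /conv -big_split; apply: eq_bigr => i _; rewrite mulrDl. Qed.

Lemma convZl {R : realType} (k : R) (f g : nat -> R) n :
  conv (fun i => k * f i) g n = k * conv f g n.
Proof. by rewrite /conv mulr_sumr; apply: eq_bigr => i _; rewrite mulrA. Qed.

(** * Coefficients of the two solutions of the second-order equation *)

(* [dT a] and [dD a] are the Taylor coefficients of [C_a] and of the power series
   [h] such that [C_a log t + h] is the second solution of the same equation;
   [T a] and [D a] are their partial sums. *)
Fixpoint T {R : realType} (a : R) n :=
  if n is m.+1 then (1 - a / n%:R ^+ 2) * T a m else 1.

Fixpoint D {R : realType} (a : R) n :=
  if n is m.+1 then (1 - a / n%:R ^+ 2) * D a m + 2 * a / n%:R ^+ 3 * T a m
  else 0.

Definition dT {R : realType} (a : R) n :=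
  if n is m.+1 then - a * T a m / n%:R ^+ 2 else 1.

Definition dD {R : realType} (a : R) n :=
  if n is m.+1 then (- a * D a m + 2 * a * T a m / n%:R) / n%:R ^+ 2 else 0.

Lemma usum_dT {R : realType} (a : R) n : usum (dT a) n.+1 = T a n.
Proof.
elim: n => [|n IH]; first by rewrite usumS usum0 add0r.
by rewrite usumS IH /=; field; rewrite nat1r pnatr_eq0.
Qed.

Lemma usum_dD {R : realType} (a : R) n : usum (dD a) n.+1 = D a n.
Proof.
elim: n => [|n IH]; first by rewrite usumS usum0 add0r.
by rewrite usumS IH /=; field; rewrite nat1r pnatr_eq0.
Qed.

Lemma theta2_dT {R : realType} (a : R) n :
  theta (theta (dT a)) n = - a * usum (dT a) n.
Proof.
case: n => [|n]; first by rewrite /theta usum0 mulr0 mul0r.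
by rewrite usum_dT /theta /=; field; rewrite nat1r pnatr_eq0.
Qed.

(** Applying [(t d/dt)^2] to [C_a log t + h] produces, besides the logarithmic part, the term
    [2 t C_a']; the equation for [h] therefore has the source [-2 t C_a']. *)
Lemma theta2_dD {R : realType} (a : R) n :
  theta (theta (dD a)) n = - a * usum (dD a) n + - 2 * theta (dT a) n.
Proof.
case: n => [|n]; first by rewrite /theta usum0; ring.
by rewrite usum_dD /theta /=; field; rewrite nat1r pnatr_eq0.
Qed.

Lemma conv_theta2_dT {R : realType} (a : R) (g : nat -> R) n :
  conv (theta (theta (dT a))) g n = - a * usum (conv (dT a) g) n.
Proof.
by rewrite usum_conv -convZl; apply: eq_conv => // i; rewrite theta2_dT.
Qed.

Lemma conv_theta2_dD {R : realType} (a : R) (g : nat -> R) n :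
  conv (theta (theta (dD a))) g n =
  - a * usum (conv (dD a) g) n + - 2 * conv (theta (dT a)) g n.
Proof.
rewrite usum_conv -!convZl -convDl.
by apply: eq_conv => // i; rewrite theta2_dD.
Qed.

(** * Products and Wronskians solving the coupled recurrence *)

Definition y1 {R : realType} (a : R) n := conv (dT a) (dT (- a)) n.

(** The Wronskian (with respect to [t d/dt]) of [C_a] and [C_(-a)], divided by [2a]. *)
Definition z1 {R : realType} (a : R) n :=
  (2 * a)^-1 * (conv (theta (dT (- a))) (dT a) n + - conv (theta (dT a)) (dT (- a)) n).

(** With [L_a = C_a log t + h_a], this is [a (L_(-a) C_a - L_a C_(-a))]: the logarithms cancel. *)
Definition y2 {R : realType} (a : R) n :=
  a * (conv (dD (- a)) (dT a) n + - conv (dD a) (dT (- a)) n).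

(** Half the sum of the Wronskians of [(C_a, L_(-a))] and [(C_(-a), L_a)]; the logarithms cancel
    again, and differentiating them leaves the first term. *)
Definition z2 {R : realType} (a : R) n :=
  2^-1 * (2 * conv (dT a) (dT (- a)) n
    + conv (theta (dD (- a))) (dT a) n + - conv (theta (dT a)) (dD (- a)) n
    + conv (theta (dD a)) (dT (- a)) n + - conv (theta (dT (- a))) (dD a) n).

(** In the derivative of a Wronskian the products of first derivatives cancel. The opposite
    parameters [a] and [-a] make the remaining two terms add up to [2a] times the product. *)
Lemma theta_z1 {R : realType} (a : R) n : a != 0 ->
  n%:R * z1 a n = usum (y1 a) n.
Proof.
move=> a0; rewrite /z1 mulrCA mulrDr mulrN !theta_conv !conv_theta2_dT.
have -> : conv (theta (dT (- a))) (theta (dT a)) n =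
          conv (theta (dT a)) (theta (dT (- a))) n by rewrite convC.
have -> : usum (conv (dT (- a)) (dT a)) n = usum (y1 a) n.
  by apply: eq_usum => i _; rewrite convC.
have -> : usum (conv (dT a) (dT (- a))) n = usum (y1 a) n by [].
by field.
Qed.

(** In the second derivative of the product the terms with [a] and [-a] cancel, leaving twice the
    product of the first derivatives; one more derivative brings in the Wronskian. *)
Lemma theta3_y1 {R : realType} (a : R) n : a != 0 ->
  n%:R ^+ 3 * y1 a n = - (4 * a ^+ 2) * usum (z1 a) n.
Proof.
move=> a0.
have -> : n%:R ^+ 3 * y1 a n = n%:R * (n%:R * (n%:R * y1 a n)) by ring.
rewrite /y1 theta_conv (convC (dT a)) mulrDr !theta_conv !conv_theta2_dT.
have -> : conv (theta (dT (- a))) (theta (dT a)) n =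
          conv (theta (dT a)) (theta (dT (- a))) n by rewrite convC.
have -> : usum (conv (dT (- a)) (dT a)) n = usum (y1 a) n.
  by apply: eq_usum => i _; rewrite convC.
have -> : usum (conv (dT a) (dT (- a))) n = usum (y1 a) n by [].
rewrite /z1 usumZ usumD usumN.
transitivity (n%:R * (2 * conv (theta (dT a)) (theta (dT (- a))) n)); first by ring.
rewrite mulrCA theta_conv conv_theta2_dT (convC (theta (dT a))) conv_theta2_dT.
have -> : usum (conv (dT a) (theta (dT (- a)))) n =
  usum (conv (theta (dT (- a))) (dT a)) n by apply: eq_usum => i _; rewrite convC.
have -> : usum (conv (dT (- a)) (theta (dT a))) n =
  usum (conv (theta (dT a)) (dT (- a))) n by apply: eq_usum => i _; rewrite convC.
by field.
Qed.

Lemma theta_z2 {R : realType} (a : R) n : n%:R * z2 a n = usum (y2 a) n.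
Proof.
rewrite /z2 /y2 usumZ usumD usumN.
rewrite mulrCA !mulrDr !mulrN (mulrCA n%:R 2) !theta_conv !conv_theta2_dT !conv_theta2_dD.
rewrite (convC (dT a) (theta (dT (- a)))).
rewrite (convC (theta (dT a)) (theta (dD (- a)))).
rewrite (convC (theta (dT (- a))) (theta (dD a))).
have -> : usum (conv (dT a) (dD (- a))) n = usum (conv (dD (- a)) (dT a)) n.
  by apply: eq_usum => i _; rewrite convC.
have -> : usum (conv (dT (- a)) (dD a)) n = usum (conv (dD a) (dT (- a))) n.
  by apply: eq_usum => i _; rewrite convC.
by field.
Qed.

(** The cancellations are those of [theta3_y1]. The source terms of [theta2_dD], visible at the end
    of [E2], give the product term of [z2] after the last derivative. *)
Lemma theta3_y2 {R : realType} (a : R) n :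
  n%:R ^+ 3 * y2 a n = - (4 * a ^+ 2) * usum (z2 a) n.
Proof.
have -> : n%:R ^+ 3 * y2 a n = n%:R * (n%:R * (n%:R * y2 a n)) by ring.
have E1 : n%:R * y2 a n = a * (conv (theta (dD (- a))) (dT a) n
    + conv (theta (dT a)) (dD (- a)) n - conv (theta (dD a)) (dT (- a)) n
    - conv (theta (dT (- a))) (dD a) n).
  rewrite /y2 mulrCA mulrDr mulrN !theta_conv.
  by rewrite (convC (dD (- a)) (theta _)) (convC (dD a) (theta _)); ring.
have E2 : n%:R * (n%:R * y2 a n) = a * (2 * conv (theta (dD (- a))) (theta (dT a)) n
    - 2 * conv (theta (dD a)) (theta (dT (- a))) n
    - 2 * conv (theta (dT (- a))) (dT a) n + 2 * conv (theta (dT a)) (dT (- a)) n).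
  rewrite E1 mulrCA !mulrDr !mulrN !theta_conv !conv_theta2_dT !conv_theta2_dD.
  rewrite (convC (theta (dT a)) (theta (dD (- a)))).
  rewrite (convC (theta (dT (- a))) (theta (dD a))).
  have -> : usum (conv (dT a) (dD (- a))) n = usum (conv (dD (- a)) (dT a)) n.
    by apply: eq_usum => i _; rewrite convC.
  have -> : usum (conv (dT (- a)) (dD a)) n = usum (conv (dD a) (dT (- a))) n.
    by apply: eq_usum => i _; rewrite convC.
  by ring.
rewrite E2 mulrCA !mulrDr !mulrN !(mulrCA n%:R 2) !theta_conv.
rewrite !conv_theta2_dT !conv_theta2_dD.
rewrite (convC (theta (dD (- a))) (theta (theta _))).
rewrite (convC (theta (dD a)) (theta (theta _))) !conv_theta2_dT.
rewrite (convC (theta (dT (- a))) (theta (dT a))).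
have S (f g : nat -> R) : usum (conv f g) n = usum (conv g f) n.
  by apply: eq_usum => i _; rewrite convC.
rewrite (S (dT a) (theta (dD (- a)))) (S (dT (- a)) (theta (dD a))).
rewrite (S (dD (- a)) (theta (dT a))) (S (dD a) (theta (dT (- a)))).
rewrite (S (dT (- a)) (dT a)).
rewrite /z2 usumZ !usumD !usumN usumZ.
by field.
Qed.

(** * A priori bounds *)

Definition harm {R : realType} n : R := usum (fun i => i.+1%:R^-1) n.

Definition invsq {R : realType} n : R := (n.+1%:R ^+ 2)^-1.

Lemma harm_ge0 {R : realType} n : 0 <= harm n :> R.
Proof. by apply: usum_ge0 => i _; rewrite invr_ge0. Qed.

Lemma harmS {R : realType} n : harm n.+1 = harm n + n.+1%:R^-1 :> R.
Proof. exact: usumS. Qed.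

Lemma harm_le {R : realType} n : harm n <= n%:R :> R.
Proof.
elim: n => [|n IH]; first by rewrite /harm usum0.
by rewrite harmS -[X in _ <= X]natr1 lerD // invf_le1 ?ltr0n ?ler1n.
Qed.

Lemma sqr_harm_le {R : realType} n : (1 + harm n) ^+ 2 <= 4 * n.+1%:R :> R.
Proof.
elim: n => [|n IH]; first by rewrite /harm usum0; lra.
rewrite harmS; set v : R := n.+1%:R^-1.
have v0 : 0 < v by rewrite invr_gt0 ltr0n.
have vn : v * n.+1%:R = 1 by rewrite mulVf // pnatr_eq0.
have v1 : v <= 1 by rewrite invf_le1 ?ltr0n // ?ler1n.
have h0 := harm_ge0 (R := R) n; have hn := harm_le (R := R) n.
have : v * (1 + harm n) <= 1 by rewrite -[X in _ <= X]vn ler_pM2l // -nat1r lerD2l.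
rewrite -[n.+2%:R]natr1; move: IH; nra.
Qed.

Lemma invsq_ge0 {R : realType} n : 0 <= invsq n :> R.
Proof. by rewrite invr_ge0 exprn_ge0. Qed.

Lemma usum_invsq_le {R : realType} n : usum invsq n <= 2 :> R.
Proof.
have S m : usum invsq m.+1 <= 2 - m.+1%:R^-1 :> R.
  elim: m => [|m IH]; first by rewrite usumS usum0 /invsq expr1n !invr1; lra.
  rewrite usumS (le_trans (lerD IH (lexx _))) // /invsq -addrA lerD2l.
  have m0 : 0 < m.+1%:R :> R by rewrite ltr0n.
  rewrite -[m.+2%:R]natr1; set x : R := m.+1%:R in m0 *.
  rewrite -subr_ge0.
  have -> : - (x + 1)^-1 - (- x^-1 + ((x + 1) ^+ 2)^-1) = (x * (x + 1) ^+ 2)^-1.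
    by field; rewrite !gt_eqF // ltr_wpDr.
  by rewrite invr_ge0 mulr_ge0 ?sqr_ge0 // ltW.
case: n => [|n]; first by rewrite usum0.
by rewrite (le_trans (S n)) // gerBl invr_ge0.
Qed.

Lemma dist0_le_usum {R : realType} (f g : nat -> R) n :
  (forall i, (i < n)%N -> `|f i.+1 - f i| <= g i) -> `|f n - f 0%N| <= usum g n.
Proof.
elim: n => [|n IH] H; first by rewrite subrr normr0 usum0.
have -> : f n.+1 - f 0%N = (f n - f 0%N) + (f n.+1 - f n) by ring.
rewrite usumS (le_trans (ler_normD _ _)) // lerD ?H //.
by apply: IH => i ni; apply: H; rewrite ltnS ltnW.
Qed.

(* Discrete Gronwall: the increment bound may presuppose the conclusion. *)
Lemma bounded_of_invsq_incr {R : realType} (f : nat -> R) C K :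
  0 <= C -> 2 * C <= K ->
  (forall n, (forall i, (i <= n)%N -> `|f i - f 0%N| <= K) ->
     `|f n.+1 - f n| <= C * invsq n) ->
  forall n, `|f n - f 0%N| <= K.
Proof.
move=> C0 CK H n.
have [m] := ubnP n; elim: m n => // m IH n /ltnSE nm.
apply: (le_trans _ CK).
apply: (@le_trans _ _ (usum (fun i => C * invsq i) n)).
  apply: dist0_le_usum => i ni; apply: H => j ji; apply: IH.
  by apply: leq_trans nm; apply: leq_ltn_trans ji ni.
by rewrite usumZ mulrC ler_wpM2r // usum_invsq_le.
Qed.

Definition transfer {R : realType} (x : R) (p q : nat -> R) :=
  forall n, p n.+1 = p n - x * q n / n.+1%:R ^+ 3 /\
            q n.+1 = q n + p n / n.+1%:R.

(** While [p] stays within [1/2] of its start, [|p| <= 2], so [q] grows at most like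
    [2 (1 + harm n)]. The steps of [p] are then at most [invsq n / 4], and these sum to at most
    [1/2], which closes the bootstrap. *)
Lemma transfer_bound {R : realType} (x : R) (p q : nat -> R) :
  0 <= x <= 1 / 8 -> `|p 0%N| <= 1 -> `|q 0%N| <= 1 -> transfer x p q ->
  forall n, `|p n - p 0%N| <= 1 / 2 /\ `|q n| <= 2 * (1 + harm n).
Proof.
move=> /andP[x0 x1] p0 q0 H.
have Q n : (forall i, (i <= n)%N -> `|p i - p 0%N| <= 1 / 2) -> `|q n| <= 2 * (1 + harm n).
  move=> hp.
  have : `|q n - q 0%N| <= usum (fun i => 2 * i.+1%:R^-1) n.
    apply: dist0_le_usum => i ni; have [_ ->] := H i.
    rewrite [q i + _]addrC addrK normrM normfV normr_nat ler_wpM2r ?invr_ge0 //.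
    have := hp i (ltnW ni); move: p0; rewrite !ler_norml; lra.
  by rewrite usumZ -/(harm n); move: q0; rewrite !ler_norml; lra.
have P : forall n, `|p n - p 0%N| <= 1 / 2.
  apply: (@bounded_of_invsq_incr _ _ (1 / 4)); try lra.
  move=> n /Q qn; have [-> _] := H n.
  rewrite [p n + _]addrC addrK normrN normrM normfV normrX normr_nat normrM (ger0_norm x0).
  have n0 : 0 < n.+1%:R :> R by rewrite ltr0n.
  have h : `|q n| <= 2 * n.+1%:R.
    by apply: (le_trans qn); rewrite ler_pM2l // -nat1r lerD2l harm_le.
  rewrite /invsq; set y : R := n.+1%:R in n0 h *.
  have -> : 1 / 4 * (y ^+ 2)^-1 = 1 / 8 * (2 * y) / y ^+ 3.
    by field; rewrite gt_eqF.
  rewrite ler_wpM2r ?invr_ge0 ?exprn_ge0 ?(ltW n0) //.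
  by apply: ler_pM.
by move=> n; split=> //; apply: Q => i _; apply: P.
Qed.

Lemma T_bound {R : realType} (a : R) n : `|a| <= 1 / 8 -> 1 / 2 <= T a n <= 3 / 2.
Proof.
move=> a8; suff : `|T a n - T a 0%N| <= 1 / 2 by rewrite ler_norml /=; lra.
move: n; apply: (@bounded_of_invsq_incr _ _ (1 / 4)); try lra.
move=> n /(_ n (leqnn n)) Tn.
have -> : T a n.+1 - T a n = - (a * T a n * invsq n) by rewrite /= /invsq; ring.
rewrite normrN normrM (ger0_norm (invsq_ge0 n)) ler_wpM2r ?invsq_ge0 // normrM.
have {}Tn : `|T a n| <= 3 / 2 by move: Tn; rewrite !ler_norml /=; lra.
have := normr_ge0 a; have := normr_ge0 (T a n); nra.
Qed.

Lemma D_bound {R : realType} (a : R) n : `|a| <= 1 / 8 -> `|D a n| <= 2.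
Proof.
move=> a8; suff : `|D a n - D a 0%N| <= 2 by rewrite /= subr0.
move: n; apply: (@bounded_of_invsq_incr _ _ 1); try lra.
move=> n /(_ n (leqnn n)); rewrite [D a 0%N]/= subr0 => Dn.
rewrite -(usum_dD a n.+1) usumS usum_dD addrC addKr /dD.
rewrite normrM normfV normrX normr_nat -/(invsq n) ler_wpM2r ?invsq_ge0 //.
rewrite (le_trans (ler_normD _ _)) // !normrM normrN normfV !normr_nat.
have /andP[T0 T1] := T_bound a n a8; rewrite [`|T a n|]ger0_norm; last lra.
set v : R := n.+1%:R^-1.
have v0 : 0 <= v by rewrite invr_ge0.
have v1 : v <= 1 by rewrite invf_le1 ?ltr0n // ler1n.
have A : 0 <= `|a| by [].
have B : `|a| * `|D a n| <= 1 / 8 * 2 by apply: ler_pM.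
have C : `|a| * T a n <= 1 / 8 * (3 / 2) by apply: ler_pM => //; lra.
have E : `|a| * T a n * v <= 1 / 8 * (3 / 2) * 1.
  by apply: ler_pM => //; apply: mulr_ge0 => //; lra.
lra.
Qed.

Lemma dT_bound {R : realType} (a : R) n : `|a| <= 1 / 8 -> `|dT a n.+1| <= invsq n.
Proof.
move=> a8; rewrite /dT normrM normfV normrX normr_nat -/(invsq n).
rewrite -[leRHS]mul1r ler_wpM2r ?invsq_ge0 // normrM normrN.
have /andP[T0 T1] := T_bound a n a8; rewrite [`|T a n|]ger0_norm; last lra.
have := normr_ge0 a; nra.
Qed.

Lemma theta_dT_bound {R : realType} (a : R) n :
  `|a| <= 1 / 8 -> `|theta (dT a) n.+1| <= n.+1%:R^-1.
Proof.
move=> a8; rewrite /theta normrM normr_nat.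
apply: le_trans (ler_wpM2l _ (dT_bound a n a8)) _ => //.
by rewrite /invsq expr2 invfM mulrA mulfV ?mul1r // pnatr_eq0.
Qed.

Lemma invsq_le {R : realType} n : invsq n <= n.+1%:R^-1 :> R.
Proof.
rewrite /invsq expr2 invfM ler_piMl // ?invr_ge0 // invf_le1 ?ltr0n // ler1n //.
Qed.

Lemma dD_bound {R : realType} (a : R) n : `|a| <= 1 / 8 -> `|dD a n.+1| <= invsq n.
Proof.
move=> a8; rewrite /dD normrM normfV normrX normr_nat -/(invsq n).
rewrite -[leRHS]mul1r ler_wpM2r ?invsq_ge0 //.
rewrite (le_trans (ler_normD _ _)) // !normrM normrN normfV !normr_nat.
have /andP[T0 T1] := T_bound a n a8; rewrite [`|T a n|]ger0_norm; last lra.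
set v : R := n.+1%:R^-1.
have v0 : 0 <= v by rewrite invr_ge0.
have v1 : v <= 1 by rewrite invf_le1 ?ltr0n // ler1n.
have A : 0 <= `|a| by [].
have B : `|a| * `|D a n| <= 1 / 8 * 2 by apply: ler_pM => //; apply: D_bound.
have C : `|a| * T a n <= 1 / 8 * (3 / 2) by apply: ler_pM => //; lra.
have E : `|a| * T a n * v <= 1 / 8 * (3 / 2) * 1.
  by apply: ler_pM => //; apply: mulr_ge0 => //; lra.
lra.
Qed.

(** * Partial sums of products, and partial fractions in the parameter *)

(* The key identity is [(1 / i^2) * (i / (n - i)) = (1/n) (1/i + 1/(n - i))]. *)
Lemma usum_conv_approx {R : realType} (f g : nat -> R) n :
  (forall i, `|f i.+1| <= invsq i) -> (forall i, `|g i.+1| <= i.+1%:R^-1) ->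
  `|usum (conv f g) n.+1 - usum f n.+1 * usum g n.+1| <= 2 * harm n / n.+1%:R.
Proof.
move=> fb gb.
have gd m k : `|usum g (m.+1 + k) - usum g m.+1| <= k%:R / m.+1%:R.
  have -> : k%:R / m.+1%:R = usum (fun=> m.+1%:R^-1) k :> R.
    by rewrite /usum sumr_const card_ord mulr_natl.
  have := @dist0_le_usum _ (fun k => usum g (m.+1 + k)) (fun=> m.+1%:R^-1) k.
  rewrite addn0; apply=> i _.
  rewrite addnS usumS addrC addKr (le_trans (gb _)) //.
  by rewrite lef_pV2 ?posrE ?ltr0n // ler_nat ltnS leq_addr.
(* With the summation moved onto [g], each [f i] multiplies a shortened partial sum of [g]; [gd]
   bounds the missing terms. *)
have -> : usum (conv f g) n.+1 = conv f (usum g) n.+1.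
  rewrite convC -usum_conv; apply: eq_usum => i _; exact: convC.
rewrite /conv big_ord_recl big_ord_recr /= subnn usum0 mulr0 addr0 subn0.
rewrite [usum f n.+1]/usum big_ord_recl mulrDl opprD addrACA subrr add0r mulr_suml -sumrB.
rewrite (le_trans (ler_norm_sum _ _ _)) //.
have -> : 2 * harm n / n.+1%:R =
    \sum_(i < n) n.+1%:R^-1 * (i.+1%:R^-1 + (n - i)%:R^-1) :> R.
  rewrite -mulr_sumr big_split /= [\sum_(i < n) (n - i)%:R^-1](reindex_inj rev_ord_inj).

  have -> : \sum_(j < n) (n - rev_ord j)%:R^-1 = harm n :> R.
    by apply: eq_bigr => i _ /=; rewrite subnA ?subnn ?add0n //.
  by rewrite [X in _ = _ * (X + _)](_ : _ = harm n) //; ring.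
apply: ler_sum => i _; rewrite /bump /= add1n subSS -mulrBr normrM.
have [k kE] : exists k, (n - i = k.+1)%N.
  by exists (n - i).-1; have := ltn_ord i; lia.
have nE : n.+1 = (k.+1 + i.+1)%N by have := ltn_ord i; lia.
rewrite kE nE distrC.
apply: le_trans (ler_pM _ _ (fb i) (gd k i.+1)) _ => //.
rewrite /invsq natrD le_eqVlt; apply/orP; left; apply/eqP.
by field; rewrite !nat1r -natrD !pnatr_eq0.
Qed.

(* [wt n m = n!^2 / ((n-m)! (n+m)!)], the partial fraction coefficients of
   [U a n / T a n] below as a function of [a]; it vanishes for [m > n]. *)
Fixpoint wt {R : realType} n m : R :=
  if m is k.+1 then wt n k * (n%:R - k%:R) / (n + m)%:R else 1.

Lemma wt_succ {R : realType} n m :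
  n.+1%:R ^+ 2 * wt n m = wt n.+1 m * (n.+1%:R ^+ 2 - m%:R ^+ 2) :> R.
Proof.
elim: m => [|m IH]; first by rewrite /=; ring.
rewrite /=.
have -> : n.+1%:R ^+ 2 * (wt n m * (n%:R - m%:R) / (n + m.+1)%:R) =
  (n.+1%:R ^+ 2 * wt n m) * ((n%:R - m%:R) / (n + m.+1)%:R) :> R by ring.
by rewrite IH; field; rewrite !nat1r -!natrD !addnS !pnatr_eq0.
Qed.

Lemma wt_tele {R : realType} n m :
  2 * m%:R * wt n m = (n + m)%:R * wt n m - (n + m.+1)%:R * wt n m.+1 :> R.
Proof.
rewrite [wt n m.+1]/= natrD; field.
by rewrite nat1r -natrD addnS pnatr_eq0.
Qed.

(** Telescoping by [wt_tele]; the upper boundary term vanishes because [wt n n.+1 = 0]. *)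
Lemma usum_wt {R : realType} n : usum (fun i => 2 * i.+1%:R * wt n i.+1) n = n%:R :> R.
Proof.
have S m : usum (fun i => 2 * i.+1%:R * wt n i.+1) m =
   n%:R - (n + m.+1)%:R * wt n m.+1 :> R.
  elim: m => [|m IH].
    by rewrite usum0 /= subr0; field; rewrite natr1 pnatr_eq0.
  by rewrite usumS IH wt_tele; ring.
by rewrite S /= subrr mulr0 mul0r mulr0 subr0.
Qed.

(** The factor introduced at step [m] is within [(2m+1)/(n+1)] of 1, and the odd numbers add up to a
    square. *)
Lemma wt_bound {R : realType} n m : (m <= n)%N ->
  0 <= (wt n m : R) <= 1 /\ 1 - wt n m <= m%:R ^+ 2 / n.+1%:R :> R.
Proof.
elim: m => [|m IH] mn; first by rewrite /= expr0n mul0r subrr !lexx ler01.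
have [/andP[w0 w1] w2] := IH (ltnW mn).
rewrite /= -natrB ?(ltnW mn) //.
set f : R := (n - m)%:R / (n + m.+1)%:R.
have f0 : 0 <= f by rewrite divr_ge0.
have f1 : f <= 1 by rewrite ler_pdivrMr ?ltr0n ?addnS // mul1r ler_nat; lia.
have f2 : 1 - f <= (2 * m + 1)%:R / n.+1%:R.
  have -> : 1 - f = (2 * m + 1)%:R / (n + m.+1)%:R.
    by rewrite /f natrB ?(ltnW mn) //; field; rewrite nat1r -natrD addnS pnatr_eq0.
  by rewrite ler_wpM2l // lef_pV2 ?posrE ?ltr0n ?addnS // ler_nat; lia.
rewrite -[wt n m * _ / _]mulrA -/f; split.
  by rewrite mulr_ge0 //= mulr_ile1.
have -> : m.+1%:R ^+ 2 / n.+1%:R = m%:R ^+ 2 / n.+1%:R + (2 * m + 1)%:R / n.+1%:R :> R.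
  by rewrite -mulrDl; congr (_ / _); rewrite -nat1r natrD natrM; ring.
set A := _ / _ in w2 *; set B := _ / _ in f2 *; nra.
Qed.

Definition U {R : realType} (a : R) n := usum (fun i => T a i / i.+1%:R) n.

Lemma usum_theta_dT {R : realType} (a : R) n : usum (theta (dT a)) n.+1 = - a * U a n.
Proof.
elim: n => [|n IH]; first by rewrite usumS /U !usum0 /theta; ring.
rewrite usumS IH /U usumS /theta /=.
by field; rewrite nat1r pnatr_eq0.
Qed.

Lemma natr_sqr_sub_ge {R : realType} (a : R) n : `|a| <= 1 / 8 ->
  n.+1%:R ^+ 2 / 2 <= n.+1%:R ^+ 2 - a.
Proof.
move=> a8; have : 1 <= n.+1%:R ^+ 2 :> R by rewrite exprn_ege1 // ler1n.
by move: a8; rewrite ler_norml; lra.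
Qed.

(** A partial fraction decomposition in [a] with poles at the squares. In the induction, [wt_succ]
    contributes [(n+1)^2 - i^2] and [usum_wt] contributes [i^2 - a]; together they give the factor
    [(n+1)^2 - a] of [T a n.+1]. *)
Lemma U_wt {R : realType} (a : R) n : `|a| <= 1 / 8 ->
  U a n = T a n * usum (fun i => 2 * wt n i.+1 * i.+1%:R / (i.+1%:R ^+ 2 - a)) n.
Proof.
move=> a8; elim: n => [|n IH]; first by rewrite /U !usum0 mulr0.
rewrite /U usumS -/(U a n) IH.
have nz m : m.+1%:R ^+ 2 - a != 0.
  have := natr_sqr_sub_ge a m a8; have : 0 < m.+1%:R ^+ 2 :> R by rewrite exprn_gt0 ?ltr0n.
  by move=> h1 h2; rewrite gt_eqF //; lra.
set S := usum _ n; set S' := usum _ n.+1.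
have E : (n.+1%:R ^+ 2 - a) * S' = n.+1%:R ^+ 2 * S + n.+1%:R.
  rewrite -[X in _ = _ + X](usum_wt n.+1) /S.
  have -> : n.+1%:R ^+ 2 * usum (fun i => 2 * wt n i.+1 * i.+1%:R / (i.+1%:R ^+ 2 - a)) n =
    usum (fun i => n.+1%:R ^+ 2 * (2 * wt n i.+1 * i.+1%:R / (i.+1%:R ^+ 2 - a))) n.+1.
    by rewrite usumZ usumS [wt n n.+1]/= subrr; ring.
  rewrite -usumZ -usumD; apply: eq_usum => i _.
  have -> : n.+1%:R ^+ 2 * (2 * wt n i.+1 * i.+1%:R / (i.+1%:R ^+ 2 - a)) =
    (n.+1%:R ^+ 2 * wt n i.+1) * (2 * i.+1%:R / (i.+1%:R ^+ 2 - a)) by ring.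
  rewrite wt_succ; move: (nz i); set d := i.+1%:R; set w := wt _ _; set e := n.+1%:R => di.
  by field; rewrite nat1r.
have -> : T a n.+1 * S' =
   T a n / n.+1%:R ^+ 2 * ((n.+1%:R ^+ 2 - a) * S').
  by rewrite /=; field; rewrite nat1r pnatr_eq0.
by rewrite E; field; rewrite nat1r pnatr_eq0.
Qed.

(** The logarithmic derivative at [s = 0] of the product of the [1 - a/(k+s)^2], as the Frobenius
    method predicts for the quotient of [D] by [T]. *)
Definition dsum {R : realType} (a : R) n :=
  usum (fun i => 2 * a / (i.+1%:R * (i.+1%:R ^+ 2 - a))) n.

Lemma D_dsum {R : realType} (a : R) n : `|a| <= 1 / 8 -> D a n = T a n * dsum a n.
Proof.
move=> a8; elim: n => [|n IH]; first by rewrite /dsum usum0 mulr0.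
rewrite /= IH /dsum usumS.
have := natr_sqr_sub_ge a n a8; have : 0 < n.+1%:R ^+ 2 :> R by rewrite exprn_gt0 ?ltr0n.
move=> h1 h2; have {h2}h : n.+1%:R ^+ 2 - a != 0 by rewrite gt_eqF //; lra.
have {h1}h1 : n.+1%:R != 0 :> R by rewrite pnatr_eq0.
move: h h1; set d : R := n.+1%:R; set s := usum _ n => h h1.
by field; rewrite !nat1r h h1.
Qed.

Lemma harm_wt {R : realType} n : harm n = usum (fun i => 2 * wt n i.+1 / i.+1%:R) n :> R.
Proof.
have : `|0 : R| <= 1 / 8 by rewrite normr0; lra.
move=> /(U_wt 0 n).
have T0 m : T 0 m = 1 :> R by elim: m => //= m ->; rewrite mul0r subr0 mulr1.
rewrite T0 mul1r => E; transitivity (U 0 n : R).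
  by apply: eq_usum => i _; rewrite T0 mul1r.
by rewrite E; apply: eq_usum => i _; rewrite subr0; field; rewrite nat1r pnatr_eq0.
Qed.

(** Split [2i/(i^2-a)] as [2/i + 2a/(i(i^2-a))] in [U_wt]. The first part sums exactly to [harm n]
    by [harm_wt]; in the second, [wt] is replaced by 1 at the cost given by [wt_bound]. *)
Lemma U_approx {R : realType} (a : R) n : `|a| <= 1 / 8 ->
  `|U a n - T a n * (harm n + dsum a n)| <= 2 * harm n / n.+1%:R.
Proof.
move=> a8; rewrite U_wt // -mulrBr normrM.
have /andP[T0 T1] := T_bound a n a8; rewrite [`|T a n|]ger0_norm; last lra.
suff H : `|usum (fun i => 2 * wt n i.+1 * i.+1%:R / (i.+1%:R ^+ 2 - a)) n
     - (harm n + dsum a n)| <= harm n / n.+1%:R.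
  have h0 : 0 <= harm n / n.+1%:R :> R by rewrite divr_ge0 ?harm_ge0.
  rewrite -mulrA; apply: ler_pM => //; lra.
rewrite [X in _ - (X + _)]harm_wt /dsum -usumD -usumN -usumD (le_trans (ler_norm_usum _ _)) //.
rewrite /harm [leRHS]mulrC -usumZ; apply: le_usum => i ni.
have dpos := natr_sqr_sub_ge a i a8.
have [/andP[w0 w1] w2] := @wt_bound R n i.+1 ni.
have d0 : 0 < i.+1%:R :> R by rewrite ltr0n.
have d2 : 0 < i.+1%:R ^+ 2 :> R by rewrite exprn_gt0.
have N0 : 0 < n.+1%:R :> R by rewrite ltr0n.
move: w0 w1 w2 dpos d0 d2 N0; move: (wt n i.+1) (i.+1%:R : R) (n.+1%:R : R).
move=> w d N w0 w1 w2 dpos d0 d2 N0.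
have da : 0 < d ^+ 2 - a by lra.
have -> : 2 * w * d / (d ^+ 2 - a) - (2 * w / d + 2 * a / (d * (d ^+ 2 - a))) =
  - (1 - w) * (2 * a / (d * (d ^+ 2 - a))).
  by field; rewrite !gt_eqF.
have w3 : 0 <= 1 - w by lra.
rewrite normrM normrN (ger0_norm w3).
have -> : N^-1 * d^-1 = d ^+ 2 / N * (d ^+ 3)^-1.
  by field; rewrite !gt_eqF.
apply: ler_pM => //.
rewrite normrM normfV [`|d * _|]normrM (ger0_norm (ltW d0)) (ger0_norm (ltW da)).
rewrite ler_pdivrMr ?mulr_gt0 // mulrA.
have -> : d ^- 3 * d = (d ^+ 2)^-1 by field; rewrite gt_eqF.
rewrite [leRHS]mulrC ler_pdivlMr // normrM normr_nat.
apply: le_trans dpos.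
nra.
Qed.

(** A common error scale: it dominates [harm n / n.+1] even after another factor of logarithmic
    growth. *)
Definition eps {R : realType} n : R := (1 + harm n) ^+ 2 / n.+1%:R.

Lemma harm_div_le_eps {R : realType} n : harm n / n.+1%:R <= eps n :> R.
Proof.
rewrite ler_wpM2r ?invr_ge0 //.
have := harm_ge0 (R := R) n; nra.
Qed.

Lemma eps_ge0 {R : realType} n : 0 <= eps n :> R.
Proof. by rewrite divr_ge0 ?sqr_ge0. Qed.

(** By Cesaro, [f n / n.+1] tends to 0 when the increments of [f] do. This is used for [1 + harm],
    then for its square, whose increments are controlled by the first use. *)
Lemma eps_cvg0 (R : realType) : (eps n : R) @[n --> \oo] --> (0 : R).
Proof.
have tele (f : nat -> R) n :
    series (fun k => if k is j.+1 then f j.+1 - f j else f 0%N) n.+1 = f n.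
  rewrite /series /= big_mkord; elim: n => [|n IH]; first by rewrite big_ord1.
  by rewrite big_ord_recr IH /= addrC subrK.
have mean (f : nat -> R) :
    (f k.+1 - f k) @[k --> \oo] --> (0 : R) ->
    (f n / n.+1%:R) @[n --> \oo] --> (0 : R).
  move=> H.
  have := @cesaro R (fun k => if k is j.+1 then f j.+1 - f j else f 0%N) 0.
  rewrite -cvg_shiftS => /(_ H).
  apply: cvg_trans; apply: near_eq_cvg; near=> n.
  by rewrite /arithmetic_mean /= tele mulrC.
have inv0 : (n.+1%:R^-1 : R) @[n --> \oo] --> (0 : R) by exact: cvg_harmonic.
have H1 : ((1 + harm n) / n.+1%:R : R) @[n --> \oo] --> (0 : R).
  apply: mean; apply: cvg_trans inv0; apply: near_eq_cvg; near=> n.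
  by rewrite harmS; ring.
apply: mean.
have : ((2 * ((1 + harm n) / n.+1%:R) + n.+1%:R^-1 * n.+1%:R^-1 : R)
   @[n --> \oo] --> (2 * 0 + 0 * 0 : R)).
  by apply: cvgD; [apply: cvgMr|apply: cvgM].
rewrite !mulr0 addr0; apply: cvg_trans; apply: near_eq_cvg; near=> n.
by rewrite harmS; ring.
Unshelve. all: by end_near. Qed.

(** * The two solutions of the recurrence and their quotients *)

Definition P1 {R : realType} (a : R) n := usum (y1 a) n.+1.
Definition Q1 {R : realType} (a : R) n := usum (z1 a) n.+1.
Definition P2 {R : realType} (a : R) n := usum (y2 a) n.+1.
Definition Q2 {R : realType} (a : R) n := usum (z2 a) n.+1.

Lemma transfer1 {R : realType} (a : R) : a != 0 -> transfer (4 * a ^+ 2) (P1 a) (Q1 a).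
Proof.
move=> a0 n; rewrite /P1 /Q1 !(usumS _ n.+1).
have n0 : n.+1%:R != 0 :> R by rewrite pnatr_eq0.
split; congr (_ + _).
  apply: (mulfI (expf_neq0 3 n0)); rewrite theta3_y1 //.
  by field; rewrite nat1r.
by apply: (mulfI n0); rewrite theta_z1 // mulrCA mulfV ?mulr1.
Qed.

Lemma transfer2 {R : realType} (a : R) : transfer (4 * a ^+ 2) (P2 a) (Q2 a).
Proof.
move=> n; rewrite /P2 /Q2 !(usumS _ n.+1).
have n0 : n.+1%:R != 0 :> R by rewrite pnatr_eq0.
split; congr (_ + _).
  apply: (mulfI (expf_neq0 3 n0)); rewrite theta3_y2 //.
  by field; rewrite nat1r.
by apply: (mulfI n0); rewrite theta_z2 // mulrCA mulfV ?mulr1.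
Qed.

Lemma conv0 {R : realType} (f g : nat -> R) : conv f g 0 = f 0%N * g 0%N.
Proof. by rewrite /conv big_ord1. Qed.

Lemma P1_0 {R : realType} (a : R) : P1 a 0 = 1.
Proof. by rewrite /P1 usumS usum0 /y1 conv0 /=; ring. Qed.

Lemma Q1_0 {R : realType} (a : R) : Q1 a 0 = 0.
Proof. by rewrite /Q1 usumS usum0 /z1 !conv0 /theta /=; ring. Qed.

Lemma P2_0 {R : realType} (a : R) : P2 a 0 = 0.
Proof. by rewrite /P2 usumS usum0 /y2 !conv0 /=; ring. Qed.

Lemma Q2_0 {R : realType} (a : R) : Q2 a 0 = 1.
Proof. by rewrite /Q2 usumS usum0 /z2 !conv0 /theta /=; field. Qed.

Lemma P1_approx {R : realType} (a : R) n : `|a| <= 1 / 8 ->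
  `|P1 a n - T a n * T (- a) n| <= 2 * (harm n / n.+1%:R).
Proof.
move=> a8; rewrite -!usum_dT mulrA; apply: usum_conv_approx => i.
  exact: dT_bound.
by rewrite (le_trans (dT_bound _ _ _)) ?normrN // invsq_le.
Qed.

Lemma P2_approx {R : realType} (a : R) n : `|a| <= 1 / 8 ->
  `|P2 a n - a * (T a n * D (- a) n - T (- a) n * D a n)| <= harm n / n.+1%:R.
Proof.
move=> a8; have a8' : `|- a| <= 1 / 8 by rewrite normrN.
have H b c : `|b| <= 1 / 8 -> `|c| <= 1 / 8 ->
    `|usum (conv (dD b) (dT c)) n.+1 - D b n * T c n| <= 2 * (harm n / n.+1%:R) :> R.
  move=> b8 c8; rewrite -usum_dT -usum_dD mulrA; apply: usum_conv_approx => i.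
    exact: dD_bound.
  by rewrite (le_trans (dT_bound _ _ _)) // invsq_le.
have := H _ _ a8' a8; have := H _ _ a8 a8'.
rewrite /P2 /y2 usumZ usumD usumN -mulrBr normrM.
have := normr_ge0 a; move: (harm n / _) (usum _ _) (usum _ _) => e v u a0 h1 h2.
have h3 : `|v - u - (T a n * D (- a) n - T (- a) n * D a n)| <= 4 * e.
  move: h1 h2; rewrite !ler_norml; lra.
apply: le_trans (ler_pM _ _ a8 h3) _ => //.
have := normr_ge0 (u - D a n * T (- a) n); lra.
Qed.

(** The error blows up as [a] tends to 0 because [z1] is divided by [2a]. This is harmless: [N]
    tends to infinity with [a] fixed. *)
Lemma Q1_approx {R : realType} (a : R) n : a != 0 -> `|a| <= 1 / 8 ->
  `|Q1 a n - (T a n * U (- a) n + T (- a) n * U a n) / 2|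
    <= 2 / `|a| * (harm n / n.+1%:R).
Proof.
move=> a0 a8; have a8' : `|- a| <= 1 / 8 by rewrite normrN.
have H b c : `|b| <= 1 / 8 -> `|c| <= 1 / 8 ->
    `|usum (conv (theta (dT b)) (dT c)) n.+1 + b * U b n * T c n|
       <= 2 * (harm n / n.+1%:R) :> R.
  move=> b8 c8; have -> : b * U b n = - usum (theta (dT b)) n.+1.
    by rewrite usum_theta_dT mulNr opprK.
  rewrite -usum_dT mulNr mulrC mulrA.
  have -> : usum (conv (theta (dT b)) (dT c)) n.+1 =
    usum (conv (dT c) (theta (dT b))) n.+1 by apply: eq_usum => i _; exact: convC.
  apply: usum_conv_approx => i; first exact: dT_bound.
  exact: theta_dT_bound.
have := H _ _ a8' a8; have := H _ _ a8 a8'.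
rewrite /Q1 /z1 usumZ usumD usumN.
move: (harm n / _) (usum _ _) (usum _ _) => e v u h1 h2.
have -> : (2 * a)^-1 * (v - u) - (T a n * U (- a) n + T (- a) n * U a n) / 2
  = (2 * a)^-1 * ((v + - a * U (- a) n * T a n) - (u + a * U a n * T (- a) n)).
  by field.
rewrite normrM normfV normrM normr_nat.
have -> : 2 / `|a| * e = (2 * `|a|)^-1 * (4 * e).
  by field; rewrite normr_eq0.
rewrite ler_wpM2l ?invr_ge0 ?mulr_ge0 //.
move: h1 h2; rewrite !ler_norml; lra.
Qed.

Lemma dsum_bound {R : realType} (a : R) n : `|a| <= 1 / 8 -> `|dsum a n| <= 4.
Proof.
move=> a8; have := D_bound a n a8; rewrite D_dsum // normrM.
have /andP[T0 T1] := T_bound a n a8; rewrite [`|T a n|]ger0_norm; last lra.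
have := normr_ge0 (dsum a n); nra.
Qed.

(** By [D_dsum] the approximations of [P1] and [P2] share the factor [T a n * T (- a) n], which
    disappears from their quotient. *)
Lemma P2_P1_approx {R : realType} (a : R) n : `|a| <= 1 / 8 ->
  `|P2 a n + P1 a n * (a * (dsum a n - dsum (- a) n))| <= 3 * eps n.
Proof.
move=> a8; have a8' : `|- a| <= 1 / 8 by rewrite normrN.
have he := @harm_div_le_eps R n.
have := P1_approx a n a8; have := P2_approx a n a8.
rewrite !D_dsum //.
have := dsum_bound a n a8; have := dsum_bound (- a) n a8'.
move: (harm n / _) (dsum a n) (dsum (- a) n) (T a n) (T (- a) n) (P1 a n) (P2 a n) he
  => e d d' t t' p1 p2 he hd' hd h2 h1.
have -> : p2 + p1 * (a * (d - d')) =
  (p2 - a * (t * (t' * d') - t' * (t * d))) + (p1 - t * t') * (a * (d - d')) by ring.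
apply: le_trans (ler_normD _ _) _.
have hb : `|a * (d - d')| <= 1 / 8 * 8.
  rewrite normrM; apply: ler_pM => //.
  by move: hd hd'; rewrite !ler_norml; lra.
have := ler_pM (normr_ge0 _) (normr_ge0 _) h1 hb.
rewrite -normrM; lra.
Qed.

(** [U_approx] extracts the same common factor from [Q1], leaving the average of [harm + dsum] over
    the parameters [a] and [-a]. *)
Lemma Q1_P1_approx {R : realType} (a : R) n : a != 0 -> `|a| <= 1 / 8 ->
  `|Q1 a n - P1 a n * (harm n + (dsum a n + dsum (- a) n) / 2)|
    <= (2 / `|a| + 11) * eps n.
Proof.
move=> a0 a8; have a8' : `|- a| <= 1 / 8 by rewrite normrN.
have he := @harm_div_le_eps R n.
have := P1_approx a n a8; have := Q1_approx a n a0 a8.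
have := U_approx a n a8; have := U_approx (- a) n a8'.
have := T_bound a n a8; have := T_bound (- a) n a8'.
have := dsum_bound a n a8; have := dsum_bound (- a) n a8'.
rewrite -!(mulrA 2 (harm n)).
(* The error of [P1] gets multiplied by a factor of size [harm n + 4]; this is where [eps] needs the
   square. *)
have hh : harm n / n.+1%:R * (harm n + 4) <= 4 * eps n :> R.
  rewrite mulrAC /eps mulrA ler_wpM2r ?invr_ge0 //.
  have := harm_ge0 (R := R) n; nra.
have e0 : 0 <= harm n / n.+1%:R :> R by rewrite divr_ge0 ?harm_ge0.
have := harm_ge0 (R := R) n; have := eps_ge0 (R := R) n.
move: e0 hh he.
move: (harm n / _) (dsum a n) (dsum (- a) n) (T a n) (T (- a) n) (P1 a n) (Q1 a n).
move: (U a n) (U (- a) n) (eps n) (harm n).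
move=> u u' E h e d d' t t' p1 q1 e0 hh he E0 h0 hd' hd /andP[t'0 t'1] /andP[t0 t1] hu' hu hq hp.
have -> : q1 - p1 * (h + (d + d') / 2) =
  (q1 - (t * u' + t' * u) / 2) + (t * (u' - t' * (h + d')) + t' * (u - t * (h + d))) / 2
   - (p1 - t * t') * (h + (d + d') / 2) by field.
apply: le_trans (ler_normD _ _) _; rewrite normrN.
apply: (@le_trans _ _ (2 / `|a| * e + 3 * e + 2 * (e * (h + 4)))); last first.
  have : 2 / `|a| * e <= 2 / `|a| * E by rewrite ler_wpM2l // divr_ge0.
  lra.
apply: lerD; last first.
  rewrite normrM mulrA; apply: ler_pM => //.
  by move: hd hd'; rewrite !ler_norml; lra.
apply: le_trans (ler_normD _ _) _; apply: lerD => //.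
rewrite normrM [`|2^-1|]ger0_norm ?invr_ge0 //.
suff : `|t * (u' - t' * (h + d')) + t' * (u - t * (h + d))| <= 6 * e by lra.
apply: le_trans (ler_normD _ _) _; rewrite !normrM (@ger0_norm _ t) ?(@ger0_norm _ t'); try lra.
have : t * `|u' - t' * (h + d')| <= 3 / 2 * (2 * e) by apply: ler_pM => //; lra.
have : t' * `|u - t * (h + d)| <= 3 / 2 * (2 * e) by apply: ler_pM => //; lra.
lra.
Qed.

(** * Expansion of the partial fractions in truncated zeta values *)

Definition zetaN {R : realType} N s : R := usum (fun i => (i.+1%:R ^+ s)^-1) N.

Lemma geometric_remainder {R : realType} (M y : R) n : 1 <= M -> 0 <= y <= 1 / 2 ->
  `|(M - y)^-1 - usum (fun k => y ^+ k / M ^+ k.+1) n| <= 2 * y ^+ n / M.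
Proof.
move=> M1 /andP[y0 y1]; have My : 0 < M - y by lra.
have M0 : 0 < M by lra.
have -> : (M - y)^-1 - usum (fun k => y ^+ k / M ^+ k.+1) n = y ^+ n / (M ^+ n * (M - y)).
  elim: n => [|n IH]; first by rewrite usum0 !expr0 !mul1r subr0.
  rewrite usumS opprD addrA IH !exprS; have := expf_neq0 n (lt0r_neq0 M0).
  move: (y ^+ n) (M ^+ n) => u v v0.
  by field; rewrite v0 !lt0r_neq0.
rewrite ger0_norm; last first.
  by rewrite divr_ge0 ?mulr_ge0 ?exprn_ge0 // ltW.
rewrite [2 * _]mulrC -mulrA ler_wpM2l ?exprn_ge0 //.
rewrite -[2]invrK -invfM lef_pV2 ?posrE ?mulr_gt0 ?exprn_gt0 ?invr_gt0 //.
have : 1 <= M ^+ n by rewrite exprn_ege1.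
nra.
Qed.

Lemma usum_exchange {R : realType} (f : nat -> nat -> R) m n :
  usum (fun i => usum (f i) n) m = usum (fun k => usum (f^~ k) m) n.
Proof. exact: exchange_big. Qed.

(** The geometric remainder at [i] is of order [y^n / i^4]; a weight of order [i] leaves at most
    [1/i^2], so the bound is uniform in [N]. *)
Lemma weighted_geometric_remainder {R : realType} (w y : R) (c : nat -> R) n N :
  0 <= y <= 1 / 2 -> 0 <= w -> (forall i, 0 <= c i <= w * i.+1%:R) ->
  `|usum (fun i => c i / (i.+1%:R ^+ 4 - y)) N
    - usum (fun k => y ^+ k * usum (fun i => c i / (i.+1%:R ^+ 4) ^+ k.+1) N) n|
  <= 4 * w * y ^+ n.
Proof.
move=> hy w0 hc; have y0 : 0 <= y by case/andP: hy.
have -> : usum (fun k => y ^+ k * usum (fun i => c i / (i.+1%:R ^+ 4) ^+ k.+1) N) n =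
   usum (fun i => c i * usum (fun k => y ^+ k / (i.+1%:R ^+ 4) ^+ k.+1) n) N.
  under eq_usum => k _ do rewrite -usumZ.
  rewrite -usum_exchange; apply: eq_usum => i _; rewrite -usumZ.
  by apply: eq_usum => k _; rewrite mulrCA.
rewrite -usumN -usumD (le_trans (ler_norm_usum _ _)) //.
apply: (@le_trans _ _ (usum (fun i => 2 * w * y ^+ n * invsq i) N)); last first.
  rewrite usumZ; have := usum_invsq_le (R := R) N.
  have : 0 <= w * y ^+ n by rewrite mulr_ge0 // exprn_ge0 //; lra.
  nra.
apply: le_usum => i _; rewrite -mulrBr normrM.
have /andP[c0 c1] := hc i; rewrite (ger0_norm c0).
have i1 : 1 <= i.+1%:R :> R by rewrite ler1n.
have := @geometric_remainder R (i.+1%:R ^+ 4) y n _ hy.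
rewrite exprn_ege1 // => /(_ isT) H.
apply: le_trans (ler_pM _ _ c1 H) _ => //.
rewrite /invsq; move: (i.+1%:R : R) i1 => d d1.
have d0 : 0 < d by lra.
have -> : w * d * (2 * y ^+ n / d ^+ 4) = 2 * w * y ^+ n * (d ^+ 3)^-1.
  by move: (y ^+ n) => Y; field; rewrite gt_eqF.
rewrite ler_wpM2l ?mulr_ge0 ?exprn_ge0 //.
rewrite lef_pV2 ?posrE ?exprn_gt0 //; exact: ler_weXn2l.
Qed.

Lemma sqr_small {R : realType} (a : R) : `|a| <= 1 / 8 -> 0 <= a ^+ 2 <= 1 / 2.
Proof. by rewrite sqr_ge0 ler_norml /=; nra. Qed.

Lemma natr_sqr_addsub_neq0 {R : realType} (a : R) n : `|a| <= 1 / 8 ->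
  (n.+1%:R ^+ 2 - a != 0) && (n.+1%:R ^+ 2 + a != 0).
Proof.
move=> a8; have := natr_sqr_sub_ge a n a8; have := natr_sqr_sub_ge (- a) n.
rewrite normrN a8 opprK => /(_ isT) h1 h2.
have h3 : 0 < n.+1%:R ^+ 2 :> R by rewrite exprn_gt0 ?ltr0n.
by apply/andP; split; rewrite gt_eqF //; lra.
Qed.

(** Over a common denominator the summand is [4 a^2 i/(i^4 - a^2)], a geometric series in
    [a^2 = x/4]. *)
Lemma dsum_sub_zeta {R : realType} (a : R) n N : `|a| <= 1 / 8 ->
  `|a * (dsum a N - dsum (- a) N)
    - usum (fun k => (4 * a ^+ 2) ^+ k.+1 * (zetaN N (4 * k + 3) / 4 ^+ k)) n|
  <= 16 * (4 * a ^+ 2) ^+ n.+1.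
Proof.
move=> a8; have y2 := sqr_small a a8.
have H := @weighted_geometric_remainder R 1 (a ^+ 2) (fun i => i.+1%:R) n N y2 ler01.
have -> : a * (dsum a N - dsum (- a) N) =
    4 * a ^+ 2 * usum (fun i => i.+1%:R / (i.+1%:R ^+ 4 - a ^+ 2)) N.
  rewrite /dsum -usumN -usumD -!usumZ; apply: eq_usum => i _.
  have := natr_sqr_addsub_neq0 a i a8; have : i.+1%:R != 0 :> R by rewrite pnatr_eq0.
  move: (i.+1%:R : R) => d d0 /andP[h1 h2].
  have h3 : d ^+ 4 - a ^+ 2 != 0.
    by rewrite (_ : _ - _ = (d ^+ 2 - a) * (d ^+ 2 + a)) ?mulf_neq0 //; ring.
  by field; rewrite opprK h3 d0 h1 h2.
have -> : usum (fun k => (4 * a ^+ 2) ^+ k.+1 * (zetaN N (4 * k + 3) / 4 ^+ k)) n =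
   4 * a ^+ 2 * usum (fun k => (a ^+ 2) ^+ k * usum (fun i => i.+1%:R / (i.+1%:R ^+ 4) ^+ k.+1) N) n.
  rewrite -usumZ; apply: eq_usum => k _.
  have -> : usum (fun i => i.+1%:R / (i.+1%:R ^+ 4) ^+ k.+1) N = zetaN N (4 * k + 3) :> R.
    apply: eq_usum => i _; rewrite -exprM mulnS.
    have -> : (4 + 4 * k = (4 * k + 3).+1)%N by lia.
    by rewrite exprS invfM mulrA mulfV ?mul1r // pnatr_eq0.
  rewrite exprS (exprMn _ 4); field.
  by rewrite expf_neq0.
have x0 : 0 <= 4 * a ^+ 2 by have := sqr_ge0 a; lra.
rewrite -mulrBr normrM (ger0_norm x0).
apply: le_trans (ler_wpM2l _ (H _)) _.
- exact: x0.
- by move=> i; rewrite mul1r ler0n lexx.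
rewrite [in leRHS]exprS (exprMn _ 4).
have : 1 <= 4 ^+ n :> R by rewrite exprn_ege1 // ler1n.
have : 0 <= (a ^+ 2) ^+ n by rewrite exprn_ge0 // sqr_ge0.
case/andP: y2; move: ((a ^+ 2) ^+ n) (4 ^+ n) => u v; move: (a ^+ 2) => y y0 _ u0 v1.
have h : 0 <= y * u by rewrite mulr_ge0.
have : 0 <= y * u * (v - 1) by rewrite mulr_ge0 // subr_ge0.
lra.
Qed.

(** Here the summand becomes [2 a^2/(i (i^4 - a^2))]. *)
Lemma dsum_add_zeta {R : realType} (a : R) n N : `|a| <= 1 / 8 ->
  `|(dsum a N + dsum (- a) N) / 2
    - usum (fun k => (4 * a ^+ 2) ^+ k.+1 * (2 / 4 ^+ k.+1 * zetaN N (4 * k.+1 + 1))) n|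
  <= 16 * (4 * a ^+ 2) ^+ n.+1.
Proof.
move=> a8; have y2 := sqr_small a a8.
have H := @weighted_geometric_remainder R 1 (a ^+ 2) (fun i => i.+1%:R^-1) n N y2 ler01.
have -> : (dsum a N + dsum (- a) N) / 2 =
    2 * a ^+ 2 * usum (fun i => i.+1%:R^-1 / (i.+1%:R ^+ 4 - a ^+ 2)) N.
  rewrite /dsum -usumD mulrC -!usumZ; apply: eq_usum => i _.
  have := natr_sqr_addsub_neq0 a i a8; have : i.+1%:R != 0 :> R by rewrite pnatr_eq0.
  move: (i.+1%:R : R) => d d0 /andP[h1 h2].
  have h3 : d ^+ 4 - a ^+ 2 != 0.
    by rewrite (_ : _ - _ = (d ^+ 2 - a) * (d ^+ 2 + a)) ?mulf_neq0 //; ring.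
  by field; rewrite opprK h3 d0 h1 h2.
have -> : usum (fun k => (4 * a ^+ 2) ^+ k.+1 * (2 / 4 ^+ k.+1 * zetaN N (4 * k.+1 + 1))) n =
   2 * a ^+ 2 * usum (fun k => (a ^+ 2) ^+ k * usum (fun i => i.+1%:R^-1 / (i.+1%:R ^+ 4) ^+ k.+1) N) n.
  rewrite -usumZ; apply: eq_usum => k _.
  have -> : usum (fun i => i.+1%:R^-1 / (i.+1%:R ^+ 4) ^+ k.+1) N = zetaN N (4 * k.+1 + 1) :> R.
    by apply: eq_usum => i _; rewrite -exprM addn1 exprS invfM.
  rewrite exprMn [(a ^+ 2) ^+ k.+1]exprS; field.
  by rewrite expf_neq0.
have x0 : 0 <= 2 * a ^+ 2 by have := sqr_ge0 a; lra.
rewrite -mulrBr normrM (ger0_norm x0).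
apply: le_trans (ler_wpM2l _ (H _)) _.
- exact: x0.
- move=> i; rewrite mul1r invr_ge0 ler0n /=.
  have : 1 <= i.+1%:R :> R by rewrite ler1n.
  by move=> h; apply: (le_trans _ h); rewrite invf_le1 ?ltr0n.
rewrite [in leRHS]exprS (exprMn _ 4).
have : 1 <= 4 ^+ n :> R by rewrite exprn_ege1 // ler1n.
have : 0 <= (a ^+ 2) ^+ n by rewrite exprn_ge0 // sqr_ge0.
case/andP: y2; move: ((a ^+ 2) ^+ n) (4 ^+ n) => u v; move: (a ^+ 2) => y y0 _ u0 v1.
have h : 0 <= y * u by rewrite mulr_ge0.
have : 0 <= y * u * (v - 1) by rewrite mulr_ge0 // subr_ge0.
lra.
Qed.

(** * A conserved quantity linking the recurrence to generating functions *)

Definition gsum {R : realType} (x : R) n (f : nat -> nat -> R) w :=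
  usum (fun k => x ^+ k * f k w) n.+1.

(** The full generating functions of [G] and [rho] satisfy the recurrence dual to [transfer], making
    [p G - q rho] constant. Truncation at degree [n] leaves only a term in [x^(n+1)]. *)
Lemma transfer_conservation {R : realType} (x : R) (p q : nat -> R)
    (G rho : nat -> nat -> R) n v :
  transfer x p q ->
  (forall k, G k v.+1 = G k v + rho k v.+1 / v.+1%:R) ->
  rho 0%N v.+1 = rho 0%N v ->
  (forall k, rho k.+1 v.+1 = rho k.+1 v - G k v.+1 / v.+1%:R ^+ 3) ->
  p v.+1 * gsum x n G v.+1 - q v.+1 * gsum x n rho v.+1 - (p v * gsum x n G v - q v * gsum x n rho v) =
  - (x ^+ n.+1 * q v * G n v.+1 / v.+1%:R ^+ 3).
Proof.
move=> H HG H0 Hr; have [-> ->] := H v.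
have EG : gsum x n G v.+1 = gsum x n G v + gsum x n rho v.+1 / v.+1%:R.
  rewrite /gsum [usum _ _ / _]mulrC -usumZ -usumD; apply: eq_usum => k _.
  by rewrite HG; ring.
have Er : gsum x n rho v.+1 = gsum x n rho v - x * gsum x n G v.+1 / v.+1%:R ^+ 3
    + x ^+ n.+1 * G n v.+1 / v.+1%:R ^+ 3.
  rewrite /gsum; clear EG; elim: n => [|n IH].
    by rewrite !usumS !usum0 !expr0 H0; ring.
  rewrite [LHS]usumS IH Hr [usum (fun k => x ^+ k * rho k v) n.+2]usumS.
  rewrite [usum (fun k => x ^+ k * G k v.+1) n.+2]usumS.
  by rewrite !(exprS x n.+1); ring.
have -> : gsum x n G v = gsum x n G v.+1 - gsum x n rho v.+1 / v.+1%:R by rewrite EG; ring.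
have -> : gsum x n rho v = gsum x n rho v.+1 + x * gsum x n G v.+1 / v.+1%:R ^+ 3
    - x ^+ n.+1 * G n v.+1 / v.+1%:R ^+ 3 by rewrite Er; ring.
by ring.
Qed.

Lemma transfer_conservation_bound {R : realType} (x : R) (p q : nat -> R)
    (G rho : nat -> nat -> R) n N K :
  0 <= x <= 1 / 8 -> `|p 0%N| <= 1 -> `|q 0%N| <= 1 -> transfer x p q ->
  (forall k v, (v < N)%N -> G k v.+1 = G k v + rho k v.+1 / v.+1%:R) ->
  (forall v, (v < N)%N -> rho 0%N v.+1 = rho 0%N v) ->
  (forall k v, (v < N)%N -> rho k.+1 v.+1 = rho k.+1 v - G k v.+1 / v.+1%:R ^+ 3) ->
  0 <= K -> (forall v, `|G n v| <= K * (1 + harm v)) ->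
  `|p N * gsum x n G N - q N * gsum x n rho N - (p 0%N * gsum x n G 0%N - q 0%N * gsum x n rho 0%N)|
    <= 32 * K * x ^+ n.+1.
Proof.
move=> x8 p0 q0 H HG H0 Hr K0 HK.
have x0 : 0 <= x by case/andP: x8.
have := @dist0_le_usum _ (fun v => p v * gsum x n G v - q v * gsum x n rho v)
  (fun v => 16 * K * x ^+ n.+1 * invsq v) N.
rewrite usumZ => A; apply: (le_trans (A _)); last first.
  have : 0 <= K * x ^+ n.+1 by rewrite mulr_ge0 ?exprn_ge0.
  by have := usum_invsq_le (R := R) N; nra.
move=> v vN; rewrite transfer_conservation //; [|by move=> k; apply: HG|exact: H0|by move=> k; apply: Hr].
rewrite normrN normrM normfV normrX normr_nat 2!normrM normrX (ger0_norm x0).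
have [_ qv] := @transfer_bound _ x p q x8 p0 q0 H v.
have hv : `|q v| * `|G n v.+1| <= 16 * K * v.+1%:R.
  apply: le_trans (ler_pM _ _ qv (HK v.+1)) _ => //.
  have h1 : 1 + harm v <= 1 + harm v.+1 :> R by rewrite harmS lerD2l lerDl invr_ge0.
  have h2 := @sqr_harm_le R v.+1.
  have h3 : v.+2%:R <= 2 * v.+1%:R :> R by rewrite -natrM ler_nat; lia.
  have h0 := @harm_ge0 R v.
  (* By [h2] and [h3] the product is at most [4 (v+2) <= 8 (v+1)]; with the 2 bounding [q] this
     gives the 16. *)
  have h4 : (1 + harm v) * (1 + harm v.+1) <= 8 * v.+1%:R :> R by nra.
  have := ler_wpM2l K0 h4; nra.
rewrite -mulrA [16 * K * _]mulrC -!mulrA ler_wpM2l ?exprn_ge0 // mulrA.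
apply: le_trans (ler_wpM2r _ hv) _; first by rewrite invr_ge0 exprn_ge0.
rewrite /invsq le_eqVlt; apply/orP; left; apply/eqP.
by field; rewrite nat1r pnatr_eq0.
Qed.

(** * Zigzag sums *)

Definition zrange N (e : bool) v := if e then iota 1 v else iota v.+1 (N - v).

Definition zweight {R : realType} (e : bool) w : R := (w%:R ^+ (if e then 1%N else 3))^-1.

(* [zig N L e v] sums over the zigzags [v >= w1 < w2 >= ...] ([e = true]) or
   [v < w1 >= w2 < ...] ([e = false]) of length [L] with entries in [1, N]. *)
Fixpoint zig {R : realType} N L (e : bool) v : R :=
  if L is L'.+1 then \sum_(w <- zrange N e v) zweight e w * zig N L' (~~ e) w else 1.

Lemma zig_true0 {R : realType} N L : zig N L.+1 true 0 = 0 :> R.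
Proof. by rewrite /= big_nil. Qed.

Lemma zig_falseN {R : realType} N L : zig N L.+1 false N = 0 :> R.
Proof. by rewrite /= subnn big_nil. Qed.

Lemma zig_trueS {R : realType} N L v :
  zig N L.+1 true v.+1 = zig N L.+1 true v + zig N L false v.+1 / v.+1%:R :> R.
Proof.
have E : iota 1 v.+1 = iota 1 v ++ [:: v.+1] by rewrite -(addn1 v) iotaD /= add1n addn1.
transitivity (\sum_(w <- iota 1 v.+1) zweight true w * zig N L false w : R); first by [].
by rewrite E big_cat big_seq1 /= /zweight expr1 [_^-1 * _]mulrC.
Qed.

Lemma zig_falseS {R : realType} N L v : (v < N)%N ->
  zig N L.+1 false v.+1 = zig N L.+1 false v - zig N L true v.+1 / v.+1%:R ^+ 3 :> R.
Proof.
move=> vN; rewrite /= -[X in _ = \sum_(w <- iota _ X) _ - _](subnSK vN) /= big_cons.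
by rewrite /zweight; ring.
Qed.

Lemma zig_ge0 {R : realType} N L e v : 0 <= zig N L e v :> R.
Proof.
elim: L e v => //= L IH e v; apply: sumr_ge0 => w _.
by rewrite mulr_ge0 // invr_ge0 exprn_ge0.
Qed.

(** Bounds independent of [N] are needed, as [N] tends to infinity. A sum starting with exponent 1
    costs a logarithm, which the next exponent 3 absorbs. *)
Lemma zig_bound {R : realType} N L v :
  zig N L true v <= 4 ^+ L * (1 + harm v) :> R /\ zig N L false v <= 4 ^+ L :> R.
Proof.
elim: L v => [|L IH] v.
  by rewrite /= expr0 mul1r lerDl harm_ge0.
have c0 : 0 <= 4 ^+ L :> R by rewrite exprn_ge0.
split.
  apply: (@le_trans _ _ (4 ^+ L * harm v)).
    elim: v => [|v IHv]; first by rewrite zig_true0 /harm usum0 mulr0.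
    rewrite zig_trueS harmS mulrDr lerD // ler_wpM2r ?invr_ge0 //.
    by have [] := IH v.+1.
  rewrite exprS; have := @harm_ge0 R v; nra.
(* Downward induction from [m = N], where the sum vanishes: each increment is paid for by a term of
   [usum invsq m], whose total is at most 2. *)
have step m : (m <= N)%N ->
    zig N L.+1 false m + 2 * 4 ^+ L * usum invsq m <= 4 ^+ L.+1 :> R.
  move=> mN; rewrite -(subKn mN); elim: (N - m)%N (leq_subr m N) => [|k IHk] kN.
    rewrite subn0 zig_falseN add0r exprS.
    by have := @usum_invsq_le R N; nra.
  apply: le_trans (IHk (ltnW kN)).
  have e : (N - k = (N - k.+1).+1)%N by lia.
  have hN : (N - k.+1 < N)%N by lia.
  rewrite e usumS (@zig_falseS R N L _ hN).
  have [h _] := IH (N - k.+1).+1.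
  suff : zig N L true (N - k.+1).+1 / (N - k.+1).+1%:R ^+ 3
    <= 2 * 4 ^+ L * invsq (N - k.+1) :> R by move: (_ / _) => A; lra.
  move: (N - k.+1)%N h => j h.
  have j0 : 0 < j.+1%:R :> R by rewrite ltr0n.
  have : zig N L true j.+1 <= 2 * 4 ^+ L * j.+1%:R :> R.
    apply: le_trans h _; have := @harm_le R j.+1.
    have : 1 <= j.+1%:R :> R by rewrite ler1n.
    by nra.
  rewrite /invsq ler_pdivrMr ?exprn_gt0 //.
  have -> : 2 * 4 ^+ L / j.+1%:R ^+ 2 * j.+1%:R ^+ 3 = 2 * 4 ^+ L * j.+1%:R :> R.
    by move: (4 ^+ L) => c; field; rewrite nat1r pnatr_eq0.
  by [].
have [vN|Nv] := leqP v N; last first.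
  by rewrite /= (eqP (ltnW Nv : N - v == 0)%N) big_nil exprn_ge0.
apply: le_trans (step v vN); rewrite lerDl mulr_ge0 ?usum_ge0 ?mulr_ge0 // => i _.
exact: invsq_ge0.
Qed.

(** * Comparison of coefficients and the limits of the zigzag sums *)

(** [C] serves all [a] while [K] may depend on [a]. By strong induction the lower coefficients tend
    to 0; after division by [x^(k+1)] there remain [C x], small by the choice of [a], and terms that
    vanish as [N] grows. *)
Lemma coefficient_cvg0 {R : realType} (u : nat -> nat -> R) :
  (forall n, exists2 C : R, 0 <= C & forall a : R, 0 < a <= 1 / 8 -> exists K, forall N,
     `|usum (fun k => (4 * a ^+ 2) ^+ k.+1 * u N k) n|
       <= C * (4 * a ^+ 2) ^+ n.+1 + K * eps N) ->
  forall k, u N k @[N --> \oo] --> (0 : R).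
Proof.
move=> H k; have [m] := ubnP k; elim: m k => // m IH k /ltnSE km.
have [C C0 HC] := H k.+1.
apply/cvgrPdist_le => e e0.
(* As [4 a <= 1/2], this gives [C x = 4 C a^2 <= e/2]; the other two errors get [e/4] each. *)
pose a : R := Num.min (1 / 8) (e / (C + 1)).
have aC : 0 < e / (C + 1) by rewrite divr_gt0 //; lra.
have a0 : 0 < a by rewrite lt_min aC andbT; lra.
have a8 : a <= 1 / 8 by rewrite ge_min lexx.
have ae : a * (C + 1) <= e.
  by rewrite -ler_pdivlMr; [rewrite ge_min lexx orbT|lra].
have [|K HK] := HC a; first by rewrite a0.
have x0 : 0 < 4 * a ^+ 2 by nra.
have xe : C * (4 * a ^+ 2) <= e / 2 by nra.
move: x0 xe HK; move: (4 * a ^+ 2) => x x0 xe HK.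
have S0 j : (j <= k)%N -> usum (fun i => x ^+ i.+1 * u N i) j @[N --> \oo] --> (0 : R).
  elim: j => [|j IHj] jk.
    by rewrite (_ : (fun N => _) = fun=> 0); [exact: cvg_cst|apply/funext => N; rewrite usum0].
  have : (usum (fun i => x ^+ i.+1 * u N i) j + x ^+ j.+1 * u N j)
      @[N --> \oo] --> (0 + x ^+ j.+1 * 0 : R).
    by apply: cvgD; [exact: IHj (ltnW jk)|apply: cvgMr; exact: IH j (leq_trans jk km)].
  rewrite mulr0 addr0; apply: cvg_trans; apply: near_eq_cvg; near=> N.
  by rewrite usumS.
have E : (K * eps N - 0) @[N --> \oo] --> (0 : R).
  by rewrite -[X in _ --> X](mulr0 K); under eq_fun do rewrite subr0; apply: cvgMr; exact: eps_cvg0.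
have d0 : 0 < x ^+ k.+1 * (e / 4) by rewrite mulr_gt0 ?exprn_gt0 //; lra.
near=> N.
have h1 : `|usum (fun i => x ^+ i.+1 * u N i) k| <= x ^+ k.+1 * (e / 4).
  near: N; have := S0 k (leqnn k) => /cvgrPdist_le /(_ _ d0).
  by apply: filterS => N; rewrite sub0r normrN.
have h2 : K * eps N <= x ^+ k.+1 * (e / 4).
  near: N; move: E => /cvgrPdist_le /(_ _ d0).
  by apply: filterS => N; rewrite sub0r normrN subr0 ler_norml => /andP[].
have := HK N; rewrite usumS => h3.
have xk : 0 < x ^+ k.+1 by rewrite exprn_gt0.
rewrite sub0r normrN -(ler_pM2l xk) -[in leLHS](ger0_norm (ltW xk)) -normrM.
have h4 : C * x ^+ k.+2 <= x ^+ k.+1 * (e / 2).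
  by rewrite [x ^+ k.+2]exprS mulrA [leRHS]mulrC ler_wpM2r // ltW.
move: h1 h3; rewrite !ler_norml; lra.
Unshelve. all: by end_near. Qed.

Lemma P1_bounds {R : realType} (a : R) n : 0 < a <= 1 / 8 -> 1 / 2 <= P1 a n <= 3 / 2.
Proof.
move=> /andP[a0 a8].
have x8 : 0 <= 4 * a ^+ 2 <= 1 / 8 by nra.
have := @transfer_bound R _ (P1 a) (Q1 a) x8.
rewrite P1_0 Q1_0 normr1 normr0 => /(_ (lexx 1) ler01).
move=> /(_ (transfer1 a (lt0r_neq0 a0)) n) [+ _].
by rewrite ler_norml; lra.
Qed.

Lemma P2_le {R : realType} (a : R) n : 0 < a <= 1 / 8 -> `|P2 a n| <= 1 / 2.
Proof.
move=> /andP[a0 a8].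
have x8 : 0 <= 4 * a ^+ 2 <= 1 / 8 by nra.
have := @transfer_bound R _ (P2 a) (Q2 a) x8.
rewrite P2_0 Q2_0 normr1 normr0 => /(_ ler01 (lexx 1)).
by move=> /(_ (transfer2 a) n) [+ _]; rewrite subr0.
Qed.

(** [rho] vanishes at [N] and [G] is 1 at 0. Conservation gives [P1 * G = 1] for the first solution
    and [P2 * G = - rho] at 0 for the second, up to [x^(n+1)]; eliminating [G] yields
    [rho = - P2 / P1]. *)
Lemma zig_B_cvg {R : realType} n :
  zig N n.*2.+1 false 0 - zetaN N (4 * n + 3) / 4 ^+ n @[N --> \oo] --> (0 : R).
Proof.
apply: (@coefficient_cvg0 R (fun N k => zig N k.*2.+1 false 0 - zetaN N (4 * k + 3) / 4 ^+ k)).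
move=> {}n; pose C : R := 32 * 4 ^+ n.*2.
have C0 : 0 <= C by rewrite mulr_ge0 // exprn_ge0.
exists (4 * C + 16); first by lra.
move=> a ha; case/andP: (ha) => a0 a8; exists 6 => N.
have na8 : `|a| <= 1 / 8 by rewrite gtr0_norm.
have x8 : 0 <= 4 * a ^+ 2 <= 1 / 8 by nra.
pose G k v : R := zig N k.*2 true v.
(* The zigzags of odd length [2j+1] sit in degree [j+1], so the degree 0 term is 0. *)
pose rho k v : R := if k is j.+1 then zig N j.*2.+1 false v else 0.
have H p q : `|p 0%N| <= 1 -> `|q 0%N| <= 1 -> transfer (4 * a ^+ 2) p q ->
  `|p N * gsum (4 * a ^+ 2) n G N - (p 0%N - q 0%N * gsum (4 * a ^+ 2) n rho 0%N)|
     <= C * (4 * a ^+ 2) ^+ n.+1.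
  move=> p0 q0 pq.
  have := @transfer_conservation_bound R _ p q G rho n N (4 ^+ n.*2) x8 p0 q0 pq.
  have -> : gsum (4 * a ^+ 2) n rho N = 0.
    have rN k : rho k N = 0 by case: k => [|k] //; exact: zig_falseN.
    by rewrite /gsum /usum big1 // => k _; rewrite rN mulr0.
  have -> : gsum (4 * a ^+ 2) n G 0 = 1.
    rewrite /gsum /usum big_ord_recl big1 ?addr0 ?expr0 ?mul1r // => k _.
    by rewrite lift0 /G doubleS zig_true0 mulr0.
  rewrite mulr0 subr0 mulr1; apply=> //.
  - case=> [|k] v vN; first by rewrite /G /rho mul0r addr0.
    by rewrite /G doubleS zig_trueS.
  - by move=> k v vN; rewrite /rho zig_falseS.
  - by move=> v; rewrite ger0_norm ?zig_ge0 //; have [] := @zig_bound R N n.*2 v.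
have /= H1 := H (P1 a) (Q1 a); have /= H2 := H (P2 a) (Q2 a).
move: H1 H2; rewrite P1_0 Q1_0 P2_0 Q2_0 normr0 normr1 mul0r mul1r subr0 sub0r opprK.
move=> /(_ (lexx 1) ler01 (transfer1 a (lt0r_neq0 a0))) H1.
move=> /(_ ler01 (lexx 1) (transfer2 a)) H2 {H}.
have H3 := P2_P1_approx a N na8.
have H4 := dsum_sub_zeta a n N na8.
have H5 := P1_bounds a N ha; have H6 := P2_le a N ha.
have -> : usum (fun k => (4 * a ^+ 2) ^+ k.+1 *
    (zig N k.*2.+1 false 0 - zetaN N (4 * k + 3) / 4 ^+ k)) n =
   gsum (4 * a ^+ 2) n rho 0 -
   usum (fun k => (4 * a ^+ 2) ^+ k.+1 * (zetaN N (4 * k + 3) / 4 ^+ k)) n.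
  have -> : gsum (4 * a ^+ 2) n rho 0 =
      usum (fun k => (4 * a ^+ 2) ^+ k.+1 * zig N k.*2.+1 false 0) n.
    rewrite /gsum /usum big_ord_recl mulr0 add0r.
    by apply: eq_bigr => k _; rewrite lift0.
  rewrite -usumN -usumD; apply: eq_usum => k _.
  by rewrite mulrBr.
move: H1 H2 H3 H4 H5 H6.
move: (usum _ n) (gsum _ _ rho _) (gsum _ _ G _) => z r g.
move: ((4 * a ^+ 2) ^+ n.+1) (a * (dsum a N - _)) (P1 a N) (P2 a N) (eps N).
move=> x d p1 p2 e H1 H2 H3 H4 /andP[H5 H5'] H6.
have H7 : `|p1 * (r - d)| <= 2 * (C * x) + 3 * e.
  have -> : p1 * (r - d) = p1 * (p2 * g + r) - p2 * (p1 * g - 1) - (p2 + p1 * d) by ring.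
  apply: le_trans (ler_normB _ _) _; apply: lerD => //.
  apply: le_trans (ler_normB _ _) _; rewrite !normrM (@ger0_norm _ p1); last lra.
  have Cx : 0 <= C * x by apply: le_trans H1.
  have : p1 * `|p2 * g + r| <= 3 / 2 * (C * x) by apply: ler_pM => //; lra.
  have : `|p2| * `|p1 * g - 1| <= 1 / 2 * (C * x) by apply: ler_pM.
  lra.
have H8 : `|r - d| <= 4 * (C * x) + 6 * e.
  move: H7; rewrite normrM (@ger0_norm _ p1); last lra.
  have := normr_ge0 (r - d); nra.
have -> : r - z = (r - d) + (d - z) by ring.
apply: le_trans (ler_normD _ _) _; lra.
Qed.

(** Now [rho] is 1 at [N] and [G] is 0 at 0, so the first solution alone gives [G = Q1 / P1] at [N],
    up to [x^(n+1)]. *)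
Lemma zig_A_cvg {R : realType} n :
  zig N n.+1.*2.+1 true N - 2 / 4 ^+ n.+1 * zetaN N (4 * n.+1 + 1)
    @[N --> \oo] --> (0 : R).
Proof.
apply: (@coefficient_cvg0 R
  (fun N k => zig N k.+1.*2.+1 true N - 2 / 4 ^+ k.+1 * zetaN N (4 * k.+1 + 1))).
move=> {}n; pose C : R := 32 * 4 ^+ n.*2.+1.
have C0 : 0 <= C by rewrite mulr_ge0 // exprn_ge0.
exists (2 * C + 16); first by lra.
move=> a ha; case/andP: (ha) => a0 a8; exists (2 * (2 / `|a| + 11)) => N.
have na8 : `|a| <= 1 / 8 by rewrite gtr0_norm.
have x8 : 0 <= 4 * a ^+ 2 <= 1 / 8 by nra.
pose G k v : R := zig N k.*2.+1 true v.
pose rho k v : R := zig N k.*2 false v.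
have H1 : `|P1 a N * gsum (4 * a ^+ 2) n G N - Q1 a N| <= C * (4 * a ^+ 2) ^+ n.+1.
  have := @transfer_conservation_bound R _ (P1 a) (Q1 a) G rho n N (4 ^+ n.*2.+1) x8.
  have -> : gsum (4 * a ^+ 2) n rho N = 1.
    rewrite /gsum /usum big_ord_recl big1 ?addr0 ?expr0 ?mul1r // => k _.
    by rewrite lift0 /rho doubleS zig_falseN mulr0.
  have -> : gsum (4 * a ^+ 2) n G 0 = 0.
    rewrite /gsum /usum big1 // => k _.
    by rewrite /G zig_true0 mulr0.
  rewrite P1_0 Q1_0 normr0 normr1 mulr0 mul0r mulr1 !subr0.
  apply=> //; try exact: ler01.
  - exact: transfer1 (lt0r_neq0 a0).
  - by move=> k v vN; rewrite /G zig_trueS.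
  - by move=> k v vN; rewrite /rho doubleS zig_falseS.
  - by move=> v; rewrite ger0_norm ?zig_ge0 //; have [] := @zig_bound R N n.*2.+1 v.
have H3 := Q1_P1_approx a N (lt0r_neq0 a0) na8.
have H4 := dsum_add_zeta a n N na8.
have H5 := P1_bounds a N ha.
have -> : usum (fun k => (4 * a ^+ 2) ^+ k.+1 *
    (zig N k.+1.*2.+1 true N - 2 / 4 ^+ k.+1 * zetaN N (4 * k.+1 + 1))) n =
   gsum (4 * a ^+ 2) n G N - harm N -
   usum (fun k => (4 * a ^+ 2) ^+ k.+1 * (2 / 4 ^+ k.+1 * zetaN N (4 * k.+1 + 1))) n.
  have -> : gsum (4 * a ^+ 2) n G N - harm N =
      usum (fun k => (4 * a ^+ 2) ^+ k.+1 * zig N k.+1.*2.+1 true N) n.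
    (* The divergent degree 0 coefficient is exactly the [harm N] of [Q1_P1_approx], and the two
       cancel before the limit. *)
    have -> : harm N = G 0%N N.
      have h v : harm v = zig N 1 true v :> R.
        elim: v => [|v IH]; first by rewrite /harm usum0 zig_true0.
        by rewrite harmS zig_trueS -IH /= mul1r.
      exact: h.
    rewrite /gsum /usum big_ord_recl expr0 mul1r addrAC subrr add0r.
    by apply: eq_bigr => k _; rewrite lift0.
  rewrite -usumN -usumD; apply: eq_usum => k _.
  by rewrite mulrBr.
move: H1 H3 H4 H5.
move: (usum _ n) (gsum _ _ G _) (harm N) => z g h.
move: ((4 * a ^+ 2) ^+ n.+1) ((dsum a N + _) / 2) (P1 a N) (Q1 a N).
move=> x d p1 q1 H1 H3 H4 /andP[H5 H5'].
have H7 : `|p1 * (g - h - d)| <= C * x + (2 / `|a| + 11) * eps N.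
  have -> : p1 * (g - h - d) = (p1 * g - q1) + (q1 - p1 * (h + d)) by ring.
  by apply: le_trans (ler_normD _ _) _; apply: lerD.
have H8 : `|g - h - d| <= 2 * (C * x) + 2 * (2 / `|a| + 11) * eps N.
  move: H7; rewrite normrM (@ger0_norm _ p1); last lra.
  rewrite -mulrA; move: (_ * eps N) => w.
  have := normr_ge0 (g - h - d); nra.
have -> : g - h - z = (g - h - d) + (d - z) by ring.
apply: le_trans (ler_normD _ _) _; lra.
Qed.

Lemma zetaN_cvg {R : realType} s : (1 < s)%N ->
  zetaN N s @[N --> \oo] --> riemann_zeta R s.
Proof.
move=> s1.
have E : (fun N => zetaN N s) = series (fun m => (m.+1%:R ^+ s)^-1 : R).
  by apply/funext => N; rewrite /series /= big_mkord.
rewrite /riemann_zeta -E; apply: nondecreasing_is_cvgn.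
  apply/nondecreasing_seqP => N.
  by rewrite /zetaN usumS lerDl invr_ge0 exprn_ge0.
exists 2 => _ [N _ <-]; apply: le_trans (@usum_invsq_le R N).
apply: le_usum => i _; rewrite lef_pV2 ?posrE ?exprn_gt0 ?ltr0n //.
by apply: ler_weXn2l => //; rewrite ler1n.
Qed.

(** * From sums over fillings to zigzag sums *)

Lemma ler_sum_subset {R : realType} {I : choiceType} (F : I -> R) (s r : seq I) :
  uniq s -> uniq r -> {subset s <= r} -> (forall x, x \in r -> 0 <= F x) ->
  \sum_(x <- s) F x <= \sum_(x <- r) F x.
Proof.
move=> us ur sr F0; rewrite [leRHS](bigID (mem s)) /=.
have -> : \sum_(x <- r | x \in s) F x = \sum_(x <- s) F x.
  rewrite -big_filter; apply: perm_big; apply: uniq_perm => //; first exact: filter_uniq.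
  by move=> x; rewrite mem_filter; case: (boolP (x \in s)) => // /sr ->.
by rewrite lerDl big_seq_cond sumr_ge0 // => x /andP[/F0].
Qed.

(** Every finite subset of [S] lies in some [r N], so the supremum over finite subsets is that of
    the increasing sums along [r]. *)
Lemma esum_exhaustion {R : realType} {I : choiceType} (S : set I) (F : I -> R)
    (r : nat -> seq I) (l : R) :
  (forall x, S x -> 0 <= F x) ->
  (forall N, uniq (r N)) -> (forall N x, x \in r N -> S x) ->
  (forall N x, x \in r N -> x \in r N.+1) -> (forall x, S x -> exists N, x \in r N) ->
  \sum_(x <- r N) F x @[N --> \oo] --> l ->
  \esum_(x in S) (F x)%:E = l%:E.
Proof.
move=> F0 ur rS rr Sr tl.
have tm : nondecreasing_seq (fun N => \sum_(x <- r N) F x).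
  by apply/nondecreasing_seqP => N; apply: ler_sum_subset => // x; [exact: rr|move/rS/F0].
have tle N : \sum_(x <- r N) F x <= l.
  by rewrite -(cvg_lim (@Rhausdorff R) tl); apply: nondecreasing_cvgn_le => //; apply/cvg_ex; exists l.
have rm N M x : (N <= M)%N -> x \in r N -> x \in r M.
  by move=> /subnK <-; elim: (M - N)%N => // k IH /IH; rewrite addSn; exact: rr.
apply/eqP; rewrite eq_le; apply/andP; split.
  apply: ge_ereal_sup => _ [X [/finite_seqP[s0 Xs0] XS] <-].
  pose s := undup s0; have us : uniq s by exact: undup_uniq.
  have Xs : X = [set` s] by rewrite Xs0; apply/seteqP; split=> x /=; rewrite mem_undup.
  rewrite Xs -fsbig_seq // sumEFin lee_fin.
  have [N HN] : exists N, {subset s <= r N}.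
    have : {in s, forall x, S x} by move=> x xs; apply: XS; rewrite Xs.
    elim: (s) => [|y t IHs] sS.
      by exists 0%N => x; rewrite in_nil.
    have [|N HN] := IHs; first by move=> x xs; apply: sS; rewrite inE xs orbT.
    have [M HM] := Sr y (sS y (mem_head _ _)).
    exists (maxn N M) => x; rewrite inE => /orP[/eqP ->|/HN].
      by apply: rm HM; exact: leq_maxr.
    by apply: rm; exact: leq_maxl.
  by apply: le_trans (tle N); apply: ler_sum_subset => // x /rS/F0.
have ge N : ((\sum_(x <- r N) F x)%:E <= \esum_(x in S) (F x)%:E)%E.
  apply: esum_ge; exists [set` r N].
    by split; [exact: finite_seq|move=> x /= /rS].
  by rewrite -fsbig_seq // sumEFin.
case: (\esum_(x in S) _) ge => [z|_|/(_ 0%N)] //; last by rewrite leey.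
move=> ge; rewrite lee_fin -(cvg_lim (@Rhausdorff R) tl).
apply: limr_le; first by apply/cvg_ex; exists l.
by near=> N; rewrite -lee_fin.
Unshelve. all: by end_near. Qed.

Fixpoint zlist N L (e : bool) v : seq (seq nat) :=
  if L is L'.+1 then [seq w :: s | w <- zrange N e v, s <- zlist N L' (~~ e) w]
  else [:: [::]].

Lemma zlistP N L e v s :
  reflect (size s = L /\ forall l, (l < L)%N ->
             nth 0%N s l \in zrange N (e (+) odd l) (nth 0%N (v :: s) l))
          (s \in zlist N L e v).
Proof.
elim: L e v s => [|L IH] e v s.
  rewrite inE; apply: (iffP eqP) => [->|[/size0nil]] //.
apply: (iffP allpairsPdep) => [[w [t [wz /IH[st Ht] ->]]]|[ss Hs]].
  split=> /= [|[|l]]; rewrite ?st //= ?addbF // ltnS => /Ht.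
  by rewrite addbN addNb.
case: s ss Hs => // w t [st] Hs; exists w, t; split=> //.
  by have := Hs 0%N isT; rewrite /= addbF.
apply/IH; split=> // l lL; have := Hs l.+1 lL.
by rewrite /= addbN addNb.
Qed.

Lemma zrange_uniq N e v : uniq (zrange N e v).
Proof. by case: e; exact: iota_uniq. Qed.

Lemma zlist_uniq N L e v : uniq (zlist N L e v).
Proof.
elim: L e v => //= L IH e v; apply: allpairs_uniq_dep => //.
- exact: zrange_uniq.
- by move=> [w s] [w' s'] _ _ /= [-> ->].
Qed.

Lemma zlist_sum {R : realType} N L e v :
  \sum_(s <- zlist N L e v) \prod_(l < L) zweight (e (+) odd l) (nth 0%N s l) =
  zig N L e v :> R.
Proof.
elim: L e v => [|L IH] e v /=; first by rewrite big_seq1 big_ord0.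
rewrite big_allpairs_dep; apply: eq_bigr => w _.
rewrite -IH mulr_sumr; apply: eq_bigr => s _.
rewrite big_ord_recl /= addbF; congr (_ * _); apply: eq_bigr => l _.
by rewrite /= addbN addNb.
Qed.

Lemma mem_zrange N e v (w : nat) :
  (w \in zrange N e v) = if e then (0 < w <= v)%N else (v < w <= N)%N.
Proof. by case: e; rewrite /zrange mem_iota; lia. Qed.

(** The cells form a path numbered from 0. A step down is strict; a step to the left is weakly
    decreasing, which is why a horizontal neighbour has its index reversed. [e] tells which kind
    falls on even indices. *)
Definition zigzag_index lam mu L (e : bool) (idx : cell lam mu -> nat) :=
  [/\ (forall c, (idx c < L)%N), (forall l, (l < L)%N -> exists c, idx c = l),
      injective idx &
      forall c d,
        (cell_row d = (cell_row c).+1 /\ cell_col d = cell_col c <->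
           idx d = (idx c).+1 /\ e (+) odd (idx d) = false) /\
        (cell_row d = cell_row c /\ cell_col d = (cell_col c).+1 <->
           idx c = (idx d).+1 /\ e (+) odd (idx c) = true)].

Definition filling_of_seq lam mu (idx : cell lam mu -> nat) (s : seq nat) :
  filling lam mu := [ffun c => nth 0%N s (idx c)].

(** The starting value, [N] before a weak descent and 0 before a strict ascent, constrains the first
    entry only to lie in [[1, N]]. *)
Lemma mem_filling_zlist lam mu L e (idx : cell lam mu -> nat) N (m : filling lam mu) :
  zigzag_index lam mu L e idx ->
  m \in [seq filling_of_seq lam mu idx s | s <- zlist N L e (if e then N else 0%N)] <->
  semistandard (lam := lam) (mu := mu) m /\ forall c, (m c <= N)%N.
Proof.
move=> [idxL surj inj adj]; split.
  case/mapP => s /zlistP[ss Hs] ->.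
  have b l : (l < L)%N -> (0 < nth 0%N s l <= N)%N.
    elim: l => [|l IH] lL; have := Hs _ lL; rewrite /= ?addbF.
      by case: (e); rewrite mem_zrange [nth _ (_ :: _) _]/=; lia.
    have := IH (ltnW lL).
    by case: (e (+) _); rewrite mem_zrange; lia.
  split; last by move=> c; rewrite ffunE; have := b _ (idxL c); lia.
  split=> [c|c d dr dc|c d dr dc]; rewrite !ffunE.
  - by have := b _ (idxL c); lia.
  - have [/(_ (conj dr dc)) [E1 E2] _] := (adj c d).1.
    have := Hs _ (idxL d); rewrite E2 mem_zrange E1 /=; lia.
  - have [/(_ (conj dr dc)) [E1 E2] _] := (adj c d).2.
    have := Hs _ (idxL c); rewrite E2 mem_zrange E1 /=; lia.
move=> [[m0 mcol mrow] mN].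
(* Each sum has a single term since [idx] is injective; this avoids naming an inverse. *)
pose s := mkseq (fun l => \sum_(c | idx c == l) m c)%N L.
have sE c : nth 0%N s (idx c) = m c.
  rewrite nth_mkseq // (bigD1 c) //= big1 ?addn0 // => d /andP[/eqP/inj ->].
  by rewrite eqxx.
apply/mapP; exists s; last by apply/ffunP => c; rewrite ffunE sE.
apply/zlistP; split=> [|l lL]; first by rewrite size_mkseq.
have [d dl] := surj l lL; rewrite -dl sE.
case: l dl lL => [|l] dl lL.
  by rewrite dl /= addbF mem_zrange; case: (e) => /=; rewrite m0 mN.
have [c cl] := surj l (ltnW lL); rewrite dl /= -cl sE.
have E : idx d = (idx c).+1 by rewrite dl cl.
rewrite mem_zrange; case E' : (e (+) ~~ odd (idx c)).
  have hE : e (+) odd (idx d) = true by rewrite E /= E'.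
  have [h1 h2] := proj2 (adj d c).2 (conj E hE).
  by rewrite m0 mrow.
have hE : e (+) odd (idx d) = false by rewrite E /= E'.
have [h1 h2] := proj2 (adj c d).1 (conj E hE).
by rewrite mN mcol.
Qed.

Lemma schur_zeta_zig {R : realType} lam mu L e (idx : cell lam mu -> nat)
    (k : filling lam mu) (l : R) :
  zigzag_index lam mu L e idx ->
  (forall c, k c = if e (+) odd (idx c) then 1%N else 3%N) ->
  zig N L e (if e then N else 0%N) @[N --> \oo] --> l ->
  schur_zeta R k = l%:E.
Proof.
move=> H kE cl; have [idxL surj inj adj] := H.
pose r N := [seq filling_of_seq lam mu idx s | s <- zlist N L e (if e then N else 0%N)].
apply: (@esum_exhaustion R _ _ _ r).
- by move=> m _; apply: prodr_ge0 => c _; rewrite invr_ge0 exprn_ge0.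
- move=> N; rewrite map_inj_in_uniq ?zlist_uniq // => s t /zlistP[ss _] /zlistP[st _] E.
  apply: (@eq_from_nth _ 0%N) => [|i]; rewrite ss ?st // => /surj[c <-].
  by have := congr1 (fun f : filling lam mu => f c) E; rewrite !ffunE.
- by move=> N m /(mem_filling_zlist _ _ _ _ _ _ _ H) [].
- move=> N m /(mem_filling_zlist _ _ _ _ _ _ _ H) [mS mN].
  by apply/(mem_filling_zlist _ _ _ _ _ _ _ H); split=> // c; exact: leqW.
- move=> m mS; exists (\max_c m c)%N.
  by apply/(mem_filling_zlist _ _ _ _ _ _ _ H); split=> // c; exact: leq_bigmax.
rewrite [X in X @ _](_ : _ = fun N => zig N L e (if e then N else 0%N)) //.
apply/funext => N; rewrite -zlist_sum big_map; apply: eq_bigr => s _.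
pose h c := Ordinal (idxL c).
have hb : bijective h.
  have g (i : 'I_L) : {c | idx c = i} by apply: cid; exact: surj.
  exists (fun i => sval (g i)) => [c|i]; last by apply: val_inj; exact: svalP (g i).
  by apply: inj; exact: svalP (g (h c)).
rewrite [RHS](reindex h) /=; last exact: onW_bij.
by apply: eq_bigr => c _; rewrite ffunE kE.
Qed.

(** * The two strip diagrams *)

Lemma cell_exists lam mu i j : in_diagram lam mu i j -> (j <= head 0%N lam)%N ->
  exists c : cell lam mu, cell_row c = i /\ cell_col c = j.
Proof.
move=> ij jl; have il : (i < (size lam).+1)%N by case/andP: ij => /andP[].
by exists (Sub (Ordinal il, Ordinal (jl : (j < (head 0 lam).+1)%N)) ij).
Qed.

Lemma cell_eq lam mu (c d : cell lam mu) :
  cell_row c = cell_row d -> cell_col c = cell_col d -> c = d.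
Proof.
by move=> h1 h2; apply: val_inj; apply/eqP; rewrite -pair_eqE; apply/andP; split; apply/eqP/val_inj.
Qed.

Lemma in_diagram_A n i j : in_diagram (A_outer n) (staircase n) i j =
  [&& 1 <= i <= n.+1, 1 <= j <= n.+1 & n.+2 <= i + j <= n.+3]%N.
Proof.
rewrite /in_diagram /= size_rev size_iota.
case: i => [|[|i]] //; first by rewrite part_staircase // /part /=; lia.
case: (leqP i.+2 n.+1) => iN; last by lia.
by rewrite part_staircase // part_A_outer //; lia.
Qed.

Lemma in_diagram_B n i j : in_diagram (staircase n.+1) (staircase n.-1) i j =
  [&& 1 <= i <= n.+1, 1 <= j & n.+1 <= i + j <= n.+2]%N.
Proof.
rewrite /in_diagram size_rev size_iota.
by case: i => [|i] //; rewrite !part_staircase //; lia.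
Qed.

Lemma cellP lam mu (c : cell lam mu) : in_diagram lam mu (cell_row c) (cell_col c).
Proof. exact: valP c. Qed.

(** On a strip of two adjacent antidiagonals [i - j] determines the cell. The shift gives index 0 to
    the top right cell [(1, n+1)], so the subtraction never truncates on either diagram. *)
Definition strip_index n lam mu (c : cell lam mu) := (cell_row c + n - cell_col c)%N.

Lemma zigzag_index_A n :
  zigzag_index (A_outer n) (staircase n) n.*2.+1 true (@strip_index n _ _).
Proof.
rewrite /strip_index; split.
- by move=> c; have := cellP _ _ c; rewrite in_diagram_A; lia.
- move=> l lL.
  (* From [(1, n+1)] this path first goes down, so rows advance at odd indices and columns at even
     ones. *)
  have [|c [cr cc]] := @cell_exists (A_outer n) (staircase n) (uphalf l).+1 (n.+1 - l./2) _ (leq_subr _ _).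
    by rewrite in_diagram_A; have := odd_double_half l; lia.
  by exists c; rewrite cr cc; have := odd_double_half l; lia.
- move=> c d; have := cellP _ _ c; have := cellP _ _ d; rewrite !in_diagram_A => h1 h2 h3.
  by apply: cell_eq; lia.
- move=> c d; have := cellP _ _ c; have := cellP _ _ d; rewrite !in_diagram_A.
  by move=> h1 h2; split; split; lia.
Qed.

Lemma zigzag_index_B n :
  zigzag_index (staircase n.+1) (staircase n.-1) n.*2.+1 false (@strip_index n _ _).
Proof.
have hd : head 0%N (staircase n.+1) = n.+1 by rewrite -nth0 -/(part _ 1) part_staircase //; lia.
rewrite /strip_index; split.
- by move=> c; have := cellP _ _ c; rewrite in_diagram_B; lia.
- move=> l lL.
  (* This path first goes left, exchanging the roles of the two halves of [l]. *)
  have [||c [cr cc]] := @cell_exists (staircase n.+1) (staircase n.-1) (l./2).+1 (n.+1 - uphalf l).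
  + by rewrite in_diagram_B; have := odd_double_half l; lia.
  + by rewrite hd leq_subr.
  by exists c; rewrite cr cc; have := odd_double_half l; lia.
- move=> c d; have := cellP _ _ c; have := cellP _ _ d; rewrite !in_diagram_B => h1 h2 h3.
  by apply: cell_eq; lia.
- move=> c d; have := cellP _ _ c; have := cellP _ _ d; rewrite !in_diagram_B.
  by move=> h1 h2; split; split; lia.
Qed.

Lemma checkerboard_value a b lam mu (k : filling lam mu) (c0 c : cell lam mu) :
  a <> b -> is_checkerboard a b k -> is_corner lam mu (cell_row c0) (cell_col c0) ->
  k c = if odd (cell_row c + cell_col c) == odd (cell_row c0 + cell_col c0) then b else a.
Proof.
move=> ab [[e kE] kb] /kb; rewrite !kE.
by case: e {kE}; case: (odd (_ c0 + _)).
Qed.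

Theorem theorem3p5 (R : realType) :
  (forall n : nat, (1 <= n)%N ->
     A13 R n = (2 / 4 ^+ n * riemann_zeta R (4 * n + 1))%:E) /\
  (forall n : nat,
     B13 R n = (1 / 4 ^+ n * riemann_zeta R (4 * n + 3))%:E).
Proof.
split=> n => [n1|].
  apply: (schur_zeta_zig _ _ _ _ _ _ _ (zigzag_index_A n)).
    (* The corner in the last row fixes which parity class carries 3. *)
    move=> c; have [|c0 [r0 k0]] := @cell_exists (A_outer n) (staircase n) n.+1 2 _ n1.
      by rewrite in_diagram_A; lia.
    rewrite (@checkerboard_value 1 3 _ _ _ c0) //.
    - rewrite r0 k0 /strip_index; have := cellP _ _ c; rewrite in_diagram_A => h.
      by case: ifP; case: ifP; lia.
    - exact/checkerboard_fillingP/A_checkerboardable.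
    - by rewrite r0 k0 /is_corner !in_diagram_A; lia.
  (* [zig_A_cvg] is indexed from 1, the length 1 sum being the divergent harmonic one. *)
  case: n n1 => // n _.
  have : (zig N n.+1.*2.+1 true N - 2 / 4 ^+ n.+1 * zetaN N (4 * n.+1 + 1)
     + 2 / 4 ^+ n.+1 * zetaN N (4 * n.+1 + 1)) @[N --> \oo]
     --> (0 + 2 / 4 ^+ n.+1 * riemann_zeta R (4 * n.+1 + 1)).
    by apply: cvgD; [exact: zig_A_cvg|apply: cvgMr; apply: zetaN_cvg; lia].
  by rewrite add0r; under eq_fun do rewrite subrK.
apply: (schur_zeta_zig _ _ _ _ _ _ _ (zigzag_index_B n)).
  move=> c; have [||c0 [r0 k0]] := @cell_exists (staircase n.+1) (staircase n.-1) n.+1 1.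
  - by rewrite in_diagram_B; lia.
  - by rewrite -nth0 -/(part _ 1) part_staircase //; lia.
  rewrite (@checkerboard_value 1 3 _ _ _ c0) //.
  - rewrite r0 k0 /strip_index; have := cellP _ _ c; rewrite in_diagram_B => h.
    by case: ifP; case: ifP; lia.
  - exact/checkerboard_fillingP/B_checkerboardable.
  - by rewrite r0 k0 /is_corner !in_diagram_B; lia.
have : (zig N n.*2.+1 false 0 - zetaN N (4 * n + 3) / 4 ^+ n + zetaN N (4 * n + 3) / 4 ^+ n)
   @[N --> \oo] --> (0 + riemann_zeta R (4 * n + 3) / 4 ^+ n).
  by apply: cvgD; [exact: zig_B_cvg|apply: cvgMl; apply: zetaN_cvg; lia].
by rewrite add0r div1r mulrC; under eq_fun do rewrite subrK.
Qed.
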